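(* Let $(X^*,X_*,R,\check R)$ be a root system of type $A_{n-1}$. Then for every dominant coweight $\mu\in X_*$ one has $\mathrm{Adm}(\mu)=\mathrm{Perm}(\mu)$.
   Context: Root data: $(X^*,X_*,R,\check R)$ is a reduced and irreducible root system: $X^*,X_*$ are free abelian groups of finite rank, dual under a perfect pairing $\langle\ ,\ \rangle:X^*\times X_*\to\mathbb Z$, with roots $R\subset X^*$ and coroots $\check R\subset X_*$. Fix a base $\Pi$, with positive roots $R^+$ and highest root $\tilde\alpha$. Let $V=X_*\otimes\mathbb R$. $W_0$ is the finite Weyl group, generated by the reflections $s_\alpha(x)=x-\langle\alpha,x\rangle\check\alpha$. A coweight is an element of $X_*$; $\mu\in X_*$ is dominant if $\langle\alpha,\mu\rangle\ge0$ for all $\alpha\in\Pi$. Affine Weyl groups: for $\alpha\in R$, $k\in\mathbb Z$, let $s_{\alpha,k}(x)=x-(\langle\alpha,x\rangle-k)\check\alpha$, with fixed hyperplane $H_{\alpha,k}$. $W_{\rm aff}$ is the group generated by all $s_{\alpha,k}$; it is a Coxeter group with generators $S_{\rm aff}=\{s_\alpha:\alpha\in\Pi\}\cup\{s_{\tilde\alpha,1}\}$. Alcoves are the connected components of $V-\bigcup_{\alpha\in R,k\in\mathbb Z}H_{\alpha,k}$; the base alcove is $A_0=\{x\in V:\langle\alpha,x\rangle>0\ \forall\alpha\in\Pi,\ \langle\tilde\alpha,x\rangle<1\}$. The extended affine Weyl group $\widetilde W=X_*\rtimes W_0$ ($\lambda\in X_*$ acting as the translation $t_\lambda$) acts on alcoves;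 $\Omega$ is the stabilizer of $A_0$ in $\widetilde W$, and $\widetilde W=W_{\rm aff}\rtimes\Omega$. The Bruhat order extends to $\widetilde W$: for $w,w'\in W_{\rm aff}$, $\tau,\tau'\in\Omega$, $w\tau\le w'\tau'$ iff $w\le w'$ in the Bruhat order of $(W_{\rm aff},S_{\rm aff})$ and $\tau=\tau'$. A vertex of $A_0$ is any point of a facet of minimal dimension of the closure of $A_0$ (a vertex in the usual sense if $R$ spans $X^*\otimes\mathbb R$; in general the condition below does not depend on the choice of the point in the facet). Admissible and permissible sets: for $\mu$ dominant let $\tau\in\Omega$ be the unique element with $t_\mu\in W_{\rm aff}\tau$, and let $\mathrm{Conv}(\mu)$ be the convex hull in $V$ of $W_0(\mu)$. Then $\mathrm{Adm}(\mu)=\{x\in\widetilde W: x\le t_\lambda\text{ for some }\lambda\in W_0(\mu)\}$, and $\mathrm{Perm}(\mu)$ is the set of $x\in W_{\rm aff}\tau$ such that $x(a)-a\in\mathrm{Conv}(\mu)$ for every vertex $a$ of $A_0$. *)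

(* Defs.v *)
From HB Require Import structures.
From Stdlib Require Import Relation_Operators.
From mathcomp Require Import all_boot all_order all_algebra.
From mathcomp Require Import finmap.
From mathcomp Require Import mathcomp_extra boolp classical_sets reals topology.
From mathcomp Require Import normedtype convex.

Set Implicit Arguments.
Unset Strict Implicit.
Unset Printing Implicit Defensive.

Import Order.TTheory GRing.Theory Num.Theory.
Import numFieldNormedType.Exports.
Local Open Scope classical_set_scope.
Local Open Scope ring_scope.

(** * Root data *)

Definition Zbasis (M : zmodType) (r : nat) (b : 'I_r -> M) : Prop :=
  forall x : M, exists! c : {ffun 'I_r -> int}, x = \sum_(i < r) b i *~ c i.

(* [chars] and [cochars] are X^* and X_*.  The values of [coroot] outside
   [roots] are irrelevant.  The Z-basis [cobasis] of X_* is arbitrary; it only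
   serves to realize X_* ⊗ R as a space of column vectors. *)
Record rootDatum := RootDatum {
  chars : zmodType;
  cochars : zmodType;
  chars_free : exists (m : nat) (e : 'I_m -> chars), Zbasis e;
  rk : nat;
  cobasis : 'I_rk -> cochars;
  cobasisP : Zbasis cobasis;
  pairing : chars -> cochars -> int;
  pairingDl : forall a b x, pairing (a + b) x = pairing a x + pairing b x;
  pairingDr : forall a x y, pairing a (x + y) = pairing a x + pairing a y;
  pairing_perfectl : forall f : {additive cochars -> int},
    exists! a : chars, forall x, f x = pairing a x;
  pairing_perfectr : forall f : {additive chars -> int},
    exists! x : cochars, forall a, f a = pairing a x;
  roots : {fset chars};
  coroot : chars -> cochars;
  coroot_inj : {in roots &, injective coroot};
  pairing_coroot : forall a, a \in roots -> pairing a (coroot a) = 2;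
  roots_stable : forall a b, a \in roots -> b \in roots ->
    b - a *~ pairing b (coroot a) \in roots;
  coroots_stable : forall a b, a \in roots -> b \in roots ->
    exists2 c, c \in roots &
      coroot c = coroot b - coroot a *~ pairing a (coroot b)
}.

(* The only rational multiples of a root that are roots are its opposite and
   itself. *)
Definition reduced (D : rootDatum) : Prop :=
  forall (a b : chars D) (p q : int), a \in roots D -> b \in roots D ->
    p != 0 -> a *~ p = b *~ q -> b = a \/ b = - a.

Definition irreducible (D : rootDatum) : Prop :=
  roots D <> fset0 /\
  forall A B : {fset chars D}, roots D = (A `|` B)%fset ->
    (forall a b, a \in A -> b \in B -> pairing a (coroot b) = 0) ->
    A = fset0 \/ B = fset0.

Definition Ncomb (D : rootDatum) (Pi : {fset chars D}) (a : chars D) : Prop :=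
  exists c : chars D -> nat, a = \sum_(b <- Pi) b *+ c b.

Definition is_base (D : rootDatum) (Pi : {fset chars D}) : Prop :=
  [/\ {subset Pi <= roots D},
      forall c : chars D -> int,
        \sum_(b <- Pi) b *~ c b = 0 -> forall b, b \in Pi -> c b = 0 &
      forall a, a \in roots D -> Ncomb Pi a \/ Ncomb Pi (- a)].

Definition positive_root (D : rootDatum) (Pi : {fset chars D}) (a : chars D) :
  Prop := a \in roots D /\ Ncomb Pi a.

Definition is_highest_root (D : rootDatum) (Pi : {fset chars D})
    (a : chars D) : Prop :=
  positive_root Pi a /\ forall b, positive_root Pi b -> Ncomb Pi (a - b).

(* Type A_m: the base can be numbered so that its Cartan matrix is that of the
   Dynkin diagram A_m, a chain with m vertices. *)
Definition type_A (D : rootDatum) (Pi : {fset chars D}) (m : nat) : Prop :=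
  exists s : 'I_m -> chars D,
    [/\ injective s,
        forall a, a \in Pi <-> exists i, a = s i &
        forall i j, pairing (s i) (coroot (s j)) =
          if i == j then 2
          else if (i.+1 == j :> nat) || (j.+1 == i :> nat) then -1 else 0].

Definition dominant (D : rootDatum) (Pi : {fset chars D}) (mu : cochars D) :
  Prop := forall a, a \in Pi -> 0 <= pairing a mu.

(** * Generated groups and Coxeter systems of transformations *)

Inductive generated (T : Type) (S : set (T -> T)) : (T -> T) -> Prop :=
| gen_id : generated S id
| gen_in f : S f -> generated S f
| gen_comp f g : generated S f -> generated S g -> generated S (f \o g)
| gen_inv f g : cancel f g -> cancel g f -> generated S f -> generated S g.

(* [word S k w]: w is a product of k elements of S.  In a Coxeter system the
   generators are involutions, so that words without inverses suffice. *)
Inductive word (T : Type) (S : set (T -> T)) : nat -> (T -> T) -> Prop :=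
| word_nil : word S 0 id
| word_cons k s w : S s -> word S k w -> word S k.+1 (s \o w).

Definition has_length (T : Type) (S : set (T -> T)) (w : T -> T) (k : nat) :
  Prop := word S k w /\ forall l, word S l w -> (k <= l)%N.

Definition reflection (T : Type) (S : set (T -> T)) (t : T -> T) : Prop :=
  exists s w w', [/\ S s, generated S w, cancel w w', cancel w' w &
    t = w \o s \o w'].

Definition bruhat_step (T : Type) (S : set (T -> T)) (x y : T -> T) : Prop :=
  exists t k l, [/\ reflection S t, y = t \o x, has_length S x k,
    has_length S y l & (k < l)%N].

Definition bruhat (T : Type) (S : set (T -> T)) : (T -> T) -> (T -> T) -> Prop :=
  clos_refl_trans (T -> T) (bruhat_step S).

(** * The space V and the affine Weyl groups *)

Notation coV R D := 'cV[R]_(rk D).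

Definition cocoord (D : rootDatum) (x : cochars D) : {ffun 'I_(rk D) -> int} :=
  sval (cid (cobasisP x)).

Definition incl (R : realType) (D : rootDatum) (x : cochars D) : coV R D :=
  \col_i (cocoord x i)%:~R.
Arguments incl R {D} x.

Definition pairingR (R : realType) (D : rootDatum) (a : chars D)
    (v : coV R D) : R :=
  \sum_(i < rk D) (pairing a (cobasis i))%:~R * v i 0.

Definition refl (R : realType) (D : rootDatum) (a : chars D) (k : int) :
    coV R D -> coV R D :=
  fun x => x - (pairingR a x - k%:~R) *: incl R (coroot a).

Definition transl (R : realType) (D : rootDatum) (v : coV R D) :
    coV R D -> coV R D :=
  fun x => x + v.

Definition W0 (R : realType) (D : rootDatum) : set (coV R D -> coV R D) :=
  generated [set s | exists2 a, a \in roots D & s = refl a 0].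
Arguments W0 : clear implicits.

Definition Waff (R : realType) (D : rootDatum) : set (coV R D -> coV R D) :=
  generated
    [set s | exists2 a, a \in roots D & exists k : int, s = refl a k].
Arguments Waff : clear implicits.

Definition Saff (R : realType) (D : rootDatum) (Pi : {fset chars D})
    (hi : chars D) : set (coV R D -> coV R D) :=
  [set s | (exists2 a, a \in Pi & s = refl a 0) \/ s = refl hi 1].
Arguments Saff R {D} Pi hi _.

(* X_* ⋊ W_0, which acts faithfully on V, is identified with its image in the
   group of transformations of V. *)
Definition Wext (R : realType) (D : rootDatum) : set (coV R D -> coV R D) :=
  [set x | exists (l : cochars D) w, W0 R D w /\ x = transl (incl R l) \o w].
Arguments Wext : clear implicits.

Definition base_alcove (R : realType) (D : rootDatum) (Pi : {fset chars D})
    (hi : chars D) : set (coV R D) :=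
  [set x | (forall a, a \in Pi -> 0 < pairingR a x) /\ pairingR hi x < 1].
Arguments base_alcove R {D} Pi hi _.

Definition Omega (R : realType) (D : rootDatum) (Pi : {fset chars D})
    (hi : chars D) : set (coV R D -> coV R D) :=
  [set t | Wext R D t /\
    t @` base_alcove R Pi hi = base_alcove R Pi hi].
Arguments Omega R {D} Pi hi _.

Definition bruhat_ext (R : realType) (D : rootDatum) (Pi : {fset chars D})
    (hi : chars D) (x y : coV R D -> coV R D) : Prop :=
  exists w w' t, [/\ Waff R D w, Waff R D w', Omega R Pi hi t,
    x = w \o t /\ y = w' \o t & bruhat (Saff R Pi hi) w w'].

(** * Facets and vertices of the base alcove *)

(* The facet through x: the points lying, for every affine root hyperplane, on
   it if x does, and strictly on the same side as x otherwise. *)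
Definition facet (R : realType) (D : rootDatum) (x : coV R D) :
    set (coV R D) :=
  [set y | forall (a : chars D) (k : int), a \in roots D ->
    Num.sg (pairingR a y - k%:~R) = Num.sg (pairingR a x - k%:~R)].

(* Dimension of the affine span. *)
Definition affine_dim (R : realType) (r : nat) (F : set 'cV[R]_r) (d : nat) :
    Prop :=
  exists (x : 'cV[R]_r) (U : {vspace 'cV[R]_r}),
    [/\ F x, forall y, F y -> y - x \in U,
        forall U' : {vspace 'cV[R]_r},
          (forall y, F y -> y - x \in U') -> (U <= U')%VS &
        \dim U = d].

Definition vertex (R : realType) (D : rootDatum) (Pi : {fset chars D})
    (hi : chars D) (a : coV R D) : Prop :=
  facet a `<=` closure (base_alcove R Pi hi) /\
  forall (b : coV R D) (d e : nat),
    facet b `<=` closure (base_alcove R Pi hi) ->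
    affine_dim (facet a) d -> affine_dim (facet b) e -> (d <= e)%N.

(** * Admissible and permissible sets *)

Definition W0_orbit (R : realType) (D : rootDatum) (mu : cochars D) :
    set (coV R D) :=
  [set v | exists2 w, W0 R D w & v = w (incl R mu)].
Arguments W0_orbit R {D} mu _.

Definition Conv (R : realType) (D : rootDatum) (mu : cochars D) :
    set (coV R D) :=
  smallest [set C : set (coV R D) | convex_set C] (W0_orbit R mu).
Arguments Conv R {D} mu _.

Definition Adm (R : realType) (D : rootDatum) (Pi : {fset chars D})
    (hi : chars D) (mu : cochars D) : set (coV R D -> coV R D) :=
  [set x | Wext R D x /\
    exists2 l, W0_orbit R mu l & bruhat_ext Pi hi x (transl l)].
Arguments Adm R {D} Pi hi mu _.

Definition Perm (R : realType) (D : rootDatum) (Pi : {fset chars D})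
    (hi : chars D) (mu : cochars D) : set (coV R D -> coV R D) :=
  [set x | exists t w w', [/\ Omega R Pi hi t,
    Waff R D w' /\ transl (incl R mu) = w' \o t,
    Waff R D w /\ x = w \o t &
    forall a, vertex Pi hi a -> Conv R mu (x a - a)]].
Arguments Perm R {D} Pi hi mu _.

(* Main.v *)
From Stdlib Require Import Relation_Operators.
From mathcomp Require Import all_boot all_order all_algebra.
From mathcomp Require Import fingroup perm.
From mathcomp Require Import finmap.
From mathcomp Require Import boolp classical_sets reals topology.
From mathcomp Require Import normedtype convex interval_inference.
From mathcomp Require Import zify ring lra.
Require Import Defs.

(* Index the coordinates of a point of V by all the integers, so that an alcove
   becomes an affine permutation p of the integers, up to a shift, and attach to
   p the numbers #{c <= i : p c >= j}. If these numbers are bounded by those of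
   q, then some reflection raises p in the Bruhat order and preserves the
   inequalities, so that p <= q.

   A permissible x is compared with t_l, where l is the point of W_0(mu) whose
   coordinates are ordered like those of the displacement of x. The indices
   contributing to #{c <= i : p c >= j} form an upper level set I of this
   displacement, and x(a) - a in Conv(mu), for a suitable vertex a, bounds the
   sum of the coordinates of x(a) - a over I by the same sum for l.

   Conversely, a step down from x in the Bruhat order is a reflection in a wall
   separating x(A_0) from A_0. It moves x(a) - a inside the segment joining it
   to its image under an element of W_0, hence inside Conv(mu). *)

Set Implicit Arguments.
Unset Strict Implicit.
Unset Printing Implicit Defensive.

Import Order.TTheory GRing.Theory Num.Theory.
Import numFieldNormedType.Exports.
Local Open Scope ring_scope.

(** * Affine permutations *)

Section AffinePermutation.
Variable n : nat.
Hypothesis n_gt0 : (0 < n)%N.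
Implicit Types (p q : int -> int) (a b c i j k : int) (I : {set 'I_n}).

(** Counts compare only affine permutations of one class modulo the affine Weyl group, while the
    coordinates of a point of V are known up to a common constant. So the permutation of [x] is
    normalized through [t_l] and [Omega], which makes the untruncated sums [lcount] of [p] and [q]
    agree, and only combinations free of the constant ([rep], [level]) are read off from V.

    The obstacle in raising [p] is periodicity: exchanging [p a] and [p b] exchanges all translates
    by [n] as well, so a count could rise by 2 where the gap to [q] is 1. The rectangle between
    [(a, p a)] and [(b, p b)] must have positive gap throughout and be disjoint from its translates.
    Its column [a] maximizes [q c - c] among the columns where [p] and [q] differ; the gap then
    vanishes just above and to the left of [(a, q a)], which forces it to be positive below. Counts
    agree far from the diagonal, so raising terminates.

    For permissible [x], the vertex depends on [j]: with coordinates floor((c - j)/n), its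
    displacement under [x] consists of the very floors that enter the count at [j]. *)

Definition floorn c : int := (c %/ n%:Z)%Z.

Definition qper p : Prop := forall c, p (c + n%:Z) = p c + n%:Z.

Definition cong a b : bool := (n%:Z %| a - b)%Z.

Lemma congP a b : reflect (exists k, a = b + k * n%:Z) (cong a b).
Proof.
apply: (iffP idP) => [/dvdzP[k e]|[k ->]]; first by exists k; rewrite -e; lia.
by apply/dvdzP; exists k; lia.
Qed.

Lemma cong_refl a : cong a a.
Proof. by apply/congP; exists 0; lia. Qed.

Lemma cong_sym a b : cong a b = cong b a.
Proof. by apply/congP/congP => -[k ->]; exists (- k); lia. Qed.

Lemma cong_trans a b c : cong a b -> cong b c -> cong a c.
Proof. by move=> /congP[k ->] /congP[l ->]; apply/congP; exists (k + l);
  lia. Qed.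

Lemma floornP c k : (k <= floorn c) = (k * n%:Z <= c).
Proof. by rewrite /floorn lez_divRL //; lia. Qed.

Lemma floornMD c k : floorn (c + k * n%:Z) = floorn c + k.
Proof. by rewrite /floorn addrC divzMDl 1?addrC //; lia. Qed.

Lemma floornD c : floorn (c + n%:Z) = floorn c + 1.
Proof. by rewrite -{1}[n%:Z]mul1r floornMD. Qed.

Lemma floorn_sub1 c : floorn (c - 1) = floorn c - (cong c 0)%:Z.
Proof.
have h1 := floornP c (floorn c); have h2 := floornP c (floorn c + 1).
have h3 := floornP (c - 1) (floorn (c - 1));
  have h4 := floornP (c - 1) (floorn (c - 1) + 1).
case: congP => [[k]|h] /=.
  rewrite add0r => e; move: h1 h2 h3 h4; rewrite lexx e => *.
  have -> : floorn (k * n%:Z) = k by nia.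
  nia.
have h5 : floorn c * n%:Z <> c by move=> e; apply: h; exists (floorn c);
  rewrite e add0r.
nia.
Qed.

Definition periodic (T : Type) (h : int -> T) := forall c, h (c + n%:Z) = h c.

Lemma periodicM (T : Type) (h : int -> T) c k :
  periodic h -> h (c + k * n%:Z) = h c.
Proof.
move=> hp; have H (l : nat) d : h (d + l%:Z * n%:Z) = h d.
  elim: l d => [|l IH] d; first by rewrite mul0r !addr0.
  have -> : d + l.+1%:Z * n%:Z = d + l%:Z * n%:Z + n%:Z by lia.
  by rewrite hp IH.
case: k => l; first exact: H.
have := H l.+1 (c + Negz l * n%:Z).
by have -> : c + Negz l * n%:Z + l.+1%:Z * n%:Z = c by lia.
Qed.

Lemma qperM p c k : qper p -> p (c + k * n%:Z) = p c + k * n%:Z.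
Proof.
move=> hp; have h : periodic (fun d => p d - d) by move=> d; rewrite hp; lia.
by have := periodicM c k h; cbv beta; lia.
Qed.

Definition res c : 'I_n := Ordinal (ltn_pmod `|(c %% n%:Z)%Z|%N n_gt0).

Lemma resE c : (res c : nat)%:Z = (c %% n%:Z)%Z.
Proof.
have h : 0 <= (c %% n%:Z)%Z < n%:Z by rewrite modz_ge0 ?ltz_pmod //; lia.
by rewrite /= modn_small; lia.
Qed.

Lemma res_divE c : c = (res c : nat)%:Z + floorn c * n%:Z.
Proof. by rewrite resE addrC -divz_eq. Qed.

Lemma cong_res c : cong c (res c : nat)%:Z.
Proof. by apply/congP; exists (floorn c); rewrite -res_divE. Qed.

Lemma res_ord (r : 'I_n) : res (r : nat)%:Z = r.
Proof. by apply: val_inj => /=;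
  rewrite modz_nat absz_nat modn_mod modn_small. Qed.

Lemma floorn_ord (r : 'I_n) : floorn (r : nat)%:Z = 0.
Proof. by rewrite /floorn divz_nat divn_small. Qed.

Lemma res_eq a b : (res a == res b) = cong a b.
Proof.
apply/eqP/idP => [e|].
  by rewrite (cong_trans (cong_res a)) // e cong_sym cong_res.
move=> /congP[k ->]; apply: val_inj => /=.
by rewrite addrC modzMDl.
Qed.

Lemma res_shift c k : res (c + k * n%:Z) = res c.
Proof. by apply/eqP; rewrite res_eq; apply/congP; exists k. Qed.

Lemma periodic_res (T : Type) (h : int -> T) c : periodic h ->
  h (res c : nat)%:Z = h c.
Proof. by move=> hh; rewrite [in RHS](res_divE c) periodicM. Qed.

Lemma sum_residues1 (h : int -> int) a : periodic h ->
  \sum_(r < n) h (r : nat)%:Z = h a + \sum_(r < n | r != res a) h (r : nat)%:Z.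
Proof. by move=> hh; rewrite (bigD1 (res a)) //= periodic_res. Qed.

Lemma sum_residues2 (h : int -> int) a b : periodic h -> ~~ cong a b ->
  \sum_(r < n) h (r : nat)%:Z =
    h a + h b + \sum_(r < n | (r != res a) && (r != res b)) h (r : nat)%:Z.
Proof.
move=> hh hab; rewrite (sum_residues1 a) // (bigD1 (res b)) /=; last first.
  by rewrite res_eq cong_sym.
by rewrite periodic_res // addrA.
Qed.

(** The affine reflection exchanging the classes of [a] and [b] modulo [n]. For congruent [a] and
    [b] it would be a shift of one class instead, hence the recurring hypothesis [~~ cong a b]. *)
Definition swapz a b c : int :=
  if cong c b then c + (a - b) else if cong c a then c + (b - a) else c.

Lemma congDn c a : cong (c + n%:Z) a = cong c a.
Proof. by apply/congP/congP => -[k e]; [exists (k-1)|exists (k+1)]; lia. Qed.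

Lemma qper_swapz a b : qper (swapz a b).
Proof. by move=> c; rewrite /swapz !congDn; case: ifP => _; [|case: ifP => _];
  lia. Qed.

Lemma swapz_l a b : ~~ cong a b -> swapz a b a = b.
Proof. by rewrite /swapz => /negPf ->; rewrite cong_refl; lia. Qed.

Lemma swapz_r a b : swapz a b b = a.
Proof. by rewrite /swapz cong_refl; lia. Qed.

Lemma swapz_out a b c : ~~ cong c a -> ~~ cong c b -> swapz a b c = c.
Proof. by rewrite /swapz => /negPf -> /negPf ->. Qed.

Lemma qper_comp p q : qper p -> qper q -> qper (p \o q).
Proof. by move=> hp hq c /=; rewrite hq hp. Qed.

(** The translates [c + k n <= i] with [p c + k n >= j] are those with [- floorn (p c - j) <= k <=
    floorn (i - c)]. This is the signed length of that range of [k]. *)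
Definition term p i j c : int := floorn (i - c) + floorn (p c - j) + 1.

Lemma periodic_term p i j : qper p -> periodic (term p i j).
Proof.
move=> hp c; rewrite /term hp.
have -> : i - c = i - (c + n%:Z) + n%:Z by lia.
have -> : p c + n%:Z - j = p c - j + n%:Z by lia.
by rewrite !floornD; lia.
Qed.

Definition pos (c : int) : int := Num.max 0 c.

(* [ncount p i j] is the number of [c <= i] such that [p c >= j]: the class of [r]
   modulo [n] contributes [pos (term p i j r)] of them. *)
Definition ncount p i j : int := \sum_(r < n) pos (term p i j (r : nat)%:Z).

(** Without truncation at 0 the sum splits into a part in the indices and a part in the values, so
    exchanging two values does not change it. Its equality for [p] and [q] stands for the equality
    of their components in [Omega]. *)
Definition lcount p i j : int := \sum_(r < n) term p i j (r : nat)%:Z.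

Lemma ncount_step p i j : qper p ->
  ncount p i j = ncount p (i - 1) j + (j <= p i)%R%:Z.
Proof.
move=> hp; rewrite /ncount.
have hh k : periodic (fun c => pos (term p k j c)) by move=> c;
  rewrite periodic_term.
rewrite !(sum_residues1 i (hh _)) addrAC; congr (_ + _); last first.
  apply: eq_bigr => r; rewrite -{1}(res_ord r) res_eq => hr; congr pos.
  rewrite /term [i - 1 - _]addrAC floorn_sub1.
  suff -> : cong (i - (r : nat)%:Z) 0 = false by rewrite subr0.
  by apply: contraNF hr => /congP[k e]; apply/congP; exists (- k); lia.
have e0 : floorn 0 = 0 by rewrite /floorn div0z.
rewrite /term; have -> : i - 1 - i = 0 - 1 by lia.
rewrite floorn_sub1 subrr e0 cong_refl /pos /=.
have := floornP (p i - j) 0; lia.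
Qed.

Lemma ncount_shift p i j : ncount p (i + n%:Z) (j + n%:Z) = ncount p i j.
Proof.
apply: eq_bigr => r _; congr pos; rewrite /term.
have -> : i + n%:Z - (r : nat)%:Z = i - (r : nat)%:Z + n%:Z by lia.
have -> : p r%:Z - j = p r%:Z - (j + n%:Z) + n%:Z by lia.
by rewrite !floornD; lia.
Qed.

Lemma ncount_shiftM p i j k : ncount p (i + k * n%:Z) (j + k * n%:Z) =
  ncount p i j.
Proof.
have h : periodic (fun c => ncount p (i + c) (j + c)) by move=> c;
  rewrite !addrA ncount_shift.
by have := periodicM 0 k h; cbv beta; rewrite add0r !addr0.
Qed.

Lemma ncount_ge0 p i j : 0 <= ncount p i j.
Proof. by apply: sumr_ge0 => r _; rewrite /pos; lia. Qed.

Lemma lcount_le_ncount p i j : lcount p i j <= ncount p i j.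
Proof. by apply: ler_sum => r _; rewrite /pos; lia. Qed.

(** By periodicity [q c - c] is bounded, so far on one side of the diagonal no term is negative and
    truncation is void, and far on the other side no term is positive. The summand [2 n] in [B]
    absorbs the rounding of the two floors. *)
Lemma ncount_far q : exists B : int, forall i j,
  (B <= i - j -> ncount q i j = lcount q i j) /\ (i - j <= - B ->
    ncount q i j = 0).
Proof.
pose B : int := \sum_(r < n) `|q (r : nat)%:Z - (r : nat)%:Z| + 2 * n%:Z.
have hB (r : 'I_n) : `|q (r : nat)%:Z - (r : nat)%:Z| + 2 * n%:Z <= B.
  rewrite /B (bigD1 r) //= -addrA lerD2l lerDr.
  by apply: sumr_ge0 => s _; lia.
exists B => i j; split=> hij.
  apply: eq_bigr => r _; have := hB r; rewrite /pos /term.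
  have := floornP (i - (r : nat)%:Z) (floorn (i - (r : nat)%:Z) + 1).
  have := floornP (q (r : nat)%:Z - j) (floorn (q (r : nat)%:Z - j) + 1).
  nia.
rewrite /ncount big1 // => r _; have := hB r; rewrite /pos /term.
have := floornP (i - (r : nat)%:Z) (floorn (i - (r : nat)%:Z)).
have := floornP (q (r : nat)%:Z - j) (floorn (q (r : nat)%:Z - j)).
nia.
Qed.

Lemma lcount_comp_swapz p a b i j : qper p -> ~~ cong a b ->
  lcount (p \o swapz a b) i j = lcount p i j.
Proof.
move=> hp hab; rewrite /lcount.
rewrite (sum_residues2 _ hab); last exact/periodic_term/qper_comp/qper_swapz.
rewrite (sum_residues2 (periodic_term i j hp) hab); congr (_ + _).
  by rewrite /term /= swapz_l // swapz_r; lia.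
apply: eq_bigr => r; rewrite -{1 2}(res_ord r) !res_eq => /andP[h1 h2].
by rewrite /term /= swapz_out.
Qed.

Lemma ncount_comp_swapz p a b i j : qper p -> ~~ cong a b ->
  ncount (p \o swapz a b) i j = ncount p i j
    + (pos (floorn (i - a) + floorn (p b - j) + 1) + pos (floorn (i - b) +
      floorn (p a - j) + 1)
    - pos (floorn (i - a) + floorn (p a - j) + 1) - pos (floorn (i - b) +
      floorn (p b - j) + 1)).
Proof.
move=> hp hab; rewrite /ncount.
have hh r : qper r -> periodic (fun c => pos (term r i j c)).
  by move=> hr c; rewrite periodic_term.
rewrite (sum_residues2 (hh _ (qper_comp hp (qper_swapz a b))) hab).
rewrite (sum_residues2 (hh _ hp) hab).
set S1 := \sum_(r < n | _) _; set S2 := \sum_(r < n | _) _.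
have -> : S1 = S2.
  apply: eq_bigr => r; rewrite -{1 2}(res_ord r) !res_eq => /andP[h1 h2].
  by rewrite /term /= swapz_out.
rewrite /term /= swapz_l // swapz_r; lia.
Qed.

(** * Raising [p] towards [q] by one reflection; [M] is the gap between their counts *)

Section Raise.
Variables p q : int -> int.
Hypotheses (hp : qper p) (hq : qper q).
Hypothesis le_pq : forall i j, ncount p i j <= ncount q i j.
Hypothesis eq_lcount : forall i j, lcount p i j = lcount q i j.

Let M i j := ncount q i j - ncount p i j.

Let M_ge0 i j : 0 <= M i j. Proof. by rewrite subr_ge0. Qed.

Let M_step i j :
  M i j = M (i - 1) j + (j <= q i)%R%:Z - (j <= p i)%R%:Z.
Proof. by rewrite /M (ncount_step i j hp) (ncount_step i j hq); lia. Qed.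

Let M_shift i j k : M (i + k * n%:Z) (j + k * n%:Z) = M i j.
Proof. by rewrite /M !ncount_shiftM. Qed.

(** The count of [p] is squeezed between [lcount p = lcount q] and the count of [q], which is
    [lcount q] there. *)
Let M_far : exists B : int, forall i j, B <= i - j -> M i j = 0.
Proof.
have [B hB] := ncount_far q; exists B => i j hij.
have := M_ge0 i j; have [/(_ hij)] := hB i j; rewrite /M -eq_lcount.
have := lcount_le_ncount p i j; lia.
Qed.

Section Column.
Variable a : int.
Let Y := q a.
Hypothesis pa_lt : p a < Y.
Hypothesis M0 : M (a - 1) (Y + 1) = 0.

Let band i := forall c, a < c -> c <= i -> ~~ cong c a -> ~~ (p a < p c <= Y).

(** The number of translates of [(a, p a)] by [l n], [l >= 1], whose value is still at most [Y]. *)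
Let K := floorn (Y - p a).

(* From [a - 1] to [i], the strip of the values between [j] and [Y] gains the
   point [(a, Y)] of [q], and loses at most the translates of [(a, p a)]. *)
Let M_band i j : band i -> a <= i -> p a < j <= Y ->
  M (a - 1) j + 1 - Num.min K (floorn (i - a)) <= M i j - M i (Y + 1).
Proof.
move=> hb hi hj; have [k ek] : exists k : nat, i = a + k%:Z.
  by exists `|i - a|%N; lia.
have K0 : 0 <= K by rewrite /K floornP; lia.
move: i ek hb hi => _ -> hb _; elim: k hb => [|k IH] hb.
  rewrite addr0 (M_step a j) (M_step a (Y + 1)) M0 subrr.
  have -> : floorn 0 = 0 by rewrite /floorn div0z.
  by rewrite -/Y; lia.
have {IH} := IH _; rewrite (M_step (a + k.+1%:Z) j) (M_step (a + k.+1%:Z) (Y +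
  1)).
have -> : a + k.+1%:Z - 1 = a + k%:Z by lia.
have e1 : a + k%:Z - a = k%:Z by lia.
have e2 : a + k.+1%:Z - a = k.+1%:Z by lia.
have := floorn_sub1 k.+1%:Z; have -> : k.+1%:Z - 1 = k%:Z by lia.
rewrite e1 e2 => e3 IH.
have {}IH := IH ltac:(by move=> c h1 h2; apply: hb; lia).
move: e3; case: (boolP (cong k.+1%:Z 0)) => h /= e3; last first.
  have := hb (a + k.+1%:Z) ltac:(lia) ltac:(lia).
  have -> : cong (a + k.+1%:Z) a = false.
    by apply: contraNF h => /congP[l e]; apply/congP; exists l; lia.
  by move=> /(_ isT); lia.
have /congP[l el] := h.
have -> : p (a + k.+1%:Z) = p a + l * n%:Z by rewrite el add0r qperM.
have el' : floorn k.+1%:Z = l by rewrite el floornMD /floorn div0z add0r.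
have := floornP (Y - p a) l; rewrite -/K.
lia.
Qed.

(** Within one period no further translate of [(a, p a)] is met, so the point [(a, Y)] of [q] is a
    net gain of 1. Shifting column [a + n - 1] back by [n] turns the gain into growth down column
    [a - 1]. *)
Let M_left_step j : band (a + n%:Z - 1) -> p a < j <= Y ->
  M (a - 1) j + 1 <= M (a - 1) (j - n%:Z).
Proof.
move=> hb hj; have := M_band hb ltac:(lia) hj.
have := M_shift (a - 1) (j - n%:Z) 1; rewrite mul1r.
have -> : a - 1 + n%:Z = a + n%:Z - 1 by lia.
have -> : j - n%:Z + n%:Z = j by lia.
have := M_ge0 (a + n%:Z - 1) (Y + 1).
have := floornP (a + n%:Z - 1 - a) 1; have := floornP (a + n%:Z - 1 - a) 0.
have : 0 <= K by rewrite /K floornP; lia.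
lia.
Qed.

Let M_left j (t : nat) : band (a + n%:Z - 1) -> p a < j + n%:Z ->
  j + t%:Z * n%:Z <= Y -> t%:Z <= M (a - 1) j.
Proof.
move=> hb; elim: t j => [|t IH] j h1 h2; first exact: M_ge0.
have {}IH := IH (j + n%:Z).
have hs := @M_left_step (j + n%:Z) hb.
rewrite addrK in hs.
have : p a < j + n%:Z <= Y by nia.
move=> /hs; have : p a < j + n%:Z + n%:Z by lia.
move=> /IH; have : j + n%:Z + t%:Z * n%:Z <= Y by nia.
move=> h /(_ h); lia.
Qed.

(** [M_band] suffices until translates of [(a, p a)] enter, at [i = a + n]. From there on a shift by
    [-n] reduces to a smaller [i], provided [j - n] is above [p a]. Otherwise the loss of at most
    [K] is outweighed by [K - 1] from column [a - 1], 1 from the point [(a, Y)], and the gap at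
    [(i, Y + 1)], positive by the same shift. *)
Lemma M_gt0_column i j : band i -> a <= i -> p a < j <= Y -> 0 < M i j.
Proof.
have [k ek] : exists k : nat, (`|i - a| <= k)%N by exists `|i - a|%N.
elim: k i j ek => [|k IH] i j ek hb hi hj.
  have := M_band hb hi hj; have -> : i - a = 0 by lia.
  have -> : floorn 0 = 0 by rewrite /floorn div0z.
  have : 0 <= K by rewrite /K floornP; lia.
  have := M_ge0 i (Y + 1); have := M_ge0 (a - 1) j; lia.
have hG := M_band hb hi hj.
have M1 := M_ge0 (a - 1) j; have M2 := M_ge0 i (Y + 1).
have K0 : 0 <= K by rewrite /K floornP; lia.
have [hi'|hi'] := ltrP i (a + n%:Z).
  have : floorn (i - a) < 1 by rewrite ltNge floornP; lia.
  lia.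
have [hK|hK] := lerP K 0; first by lia.
have hb' : band (i - n%:Z) by move=> c h1 h2; apply: hb; lia.
have hb'' : band (a + n%:Z - 1) by move=> c h1 h2; apply: hb; lia.
have hKn := floornP (Y - p a) 1; rewrite -/K in hKn.
have IH' j' : p a < j' - n%:Z <= Y -> 0 < M i j'.
  move=> h; have := IH (i - n%:Z) (j' - n%:Z) ltac:(lia) hb' ltac:(lia) h.
  have := M_shift (i - n%:Z) (j' - n%:Z) 1; rewrite mul1r.
  by rewrite !subrK => ->.
have [hj'|hj'] := ltrP (p a) (j - n%:Z); first by apply: IH'; lia.
have M3 : 0 < M i (Y + 1) by apply: IH'; lia.
have hKK := floornP (Y - p a) K; rewrite -/K lexx in hKK.
(* [K - 1] steps of length [n] fit between [j] and [Y], because here [j <= p a + n] and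
   [p a + K n <= Y]. *)
have [t et] : exists t : nat, t%:Z = K - 1 by exists `|K - 1|%N; lia.
have : t%:Z <= M (a - 1) j by apply: M_left => //; [lia|nia].
lia.
Qed.

(** [b] is the first column after [a], outside its class, with a point of [p] in the rows above
    [p a] up to [Y]; before it [M_gt0_column] applies. If there were none, the gap would be positive
    arbitrarily far to the right, against [M_far]. *)
Lemma column_rectangle :
  exists b, [/\ a < b, ~~ cong b a, p a < p b <= Y &
    forall i j, a <= i < b -> p a < j <= Y -> 0 < M i j].
Proof.
pose P (k : nat) := [&& (0 < k)%N, ~~ cong (a + k%:Z) a & p a < p (a + k%:Z) <=
  Y].
have exP : exists l : nat, P l.
  apply: contrapT => hP; have [B hB] := M_far.
  have hb i : band i.
    move=> c h1 _ h3; apply/negP => h4; apply: hP; exists `|c - a|%N.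
    have e : a + `|c - a|%N%:Z = c by lia.
    by rewrite /P e h3 h4; lia.
  have := hB (a + `|(B + Y - a)%R|%N%:Z) Y ltac:(lia).
  have := @M_gt0_column (a + `|(B + Y - a)%R|%N%:Z) Y (hb _) ltac:(lia)
    ltac:(lia).
  lia.
case: (ex_minnP exP) => k /and3P[k1 k2 k3] kmin; exists (a + k%:Z).
split=> // [|i j hi hj]; first by lia.
apply: M_gt0_column => //; last by lia.
move=> c h1 h2 h3; apply/negP => h4.
have /kmin : P `|c - a|%N.
  have e : a + `|c - a|%N%:Z = c by lia.
  by rewrite /P e h3 h4; lia.
lia.
Qed.

End Column.

Let rectangle a b : Prop := [/\ a < b, ~~ cong a b, p a < p b &
  forall i j, a <= i < b -> p a < j <= p b -> 0 < M i j].

(** Replacing the corner [(a, p a)] by its translate by [n] gives a subrectangle of smaller width,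
    as long as it fits. *)
Lemma rectangle_minimal a b : rectangle a b -> exists a' b',
  rectangle a' b' /\ ~ (a' + n%:Z < b' /\ p a' + n%:Z < p b').
Proof.
have [k hk] : exists k : nat, b - a <= k%:Z by exists `|b - a|%N; lia.
elim: k a b hk => [|k IH] a b hk hr; first by case: hr; lia.
have [[h1 h2]|h] := EM (a + n%:Z < b /\ p a + n%:Z < p b); last by exists a, b.
apply: (IH (a + n%:Z) b); first by lia.
have [_ r2 _ r4] := hr; split=> //; rewrite ?congDn ?hp // => i j hi hj.
by apply: r4; lia.
Qed.

(** The exchange adds 1 at [(i, j)] for each translate of the rectangle containing that point.
    Minimality makes the translates disjoint, so the count rises by at most 1, and only where the
    gap is positive. *)
Lemma ncount_comp_swapz_le a b : rectangle a b ->
  ~ (a + n%:Z < b /\ p a + n%:Z < p b) ->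
  forall i j, ncount (p \o swapz a b) i j <= ncount q i j.
Proof.
move=> [r1 r2 r3 r4] hmin i j; rewrite ncount_comp_swapz //.
have hle := le_pq i j.
set u := floorn (i - a); set v := floorn (i - b).
set s := floorn (p a - j); set t := floorn (p b - j).
have hvu : v <= u by rewrite floornP; have := floornP (i - b) v; rewrite lexx;
  lia.
have hst : s <= t by rewrite floornP; have := floornP (p a - j) s;
  rewrite lexx; lia.
(* The translates by [k * n] of the rectangle which contain [(i, j)]. *)
have hk k : v < k -> k <= u -> s < - k -> - k <= t ->
  [/\ a + k * n%:Z <= i, i < b + k * n%:Z, p a + k * n%:Z < j & j <= p b + k *
    n%:Z].
  move=> k1 k2 k3 k4; have := floornP (i - a) k; have := floornP (i - b) k.
  have := floornP (p a - j) (- k); have := floornP (p b - j) (- k).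
  by rewrite -/u -/v -/s -/t; split; lia.
have hM k : v < k -> k <= u -> s < - k -> - k <= t -> 0 < M i j.
  move=> k1 k2 k3 k4; have [c1 c2 c3 c4] := hk k k1 k2 k3 k4.
  rewrite -(M_shift i j (- k)); apply: r4; lia.
have h1 k : v < k -> k < u -> s < - k - 1 -> - k <= t -> False.
  move=> k1 k2 k3 k4; apply: hmin.
  have [c1 c2 c3 c4] := hk k ltac:(lia) ltac:(lia) ltac:(lia) ltac:(lia).
  have [d1 d2 d3 d4] := hk (k + 1) ltac:(lia) ltac:(lia) ltac:(lia) ltac:(lia).
  by split; lia.
(* The admissible [k] form an interval ending at this minimum; if it had two elements, the last two
   would contradict [h1]. *)
have hM1 := hM (Num.min u (- s - 1)); have h11 := h1 (Num.min u (- s - 1) - 1).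
rewrite /M in hM1; rewrite /pos; lia.
Qed.

Lemma raise : (exists c, p c <> q c) -> exists a b,
  [/\ a < b, ~~ cong a b, p a < p b &
      forall i j, ncount (p \o swapz a b) i j <= ncount q i j].
Proof.
move=> [c0 hc0].
have hres c : p c != q c -> p (res c : nat)%:Z != q (res c : nat)%:Z.
  by move=> h; move: h; rewrite [in p c](res_divE c) [in q c](res_divE c)
    !qperM //; lia.
have /eqP/hres hr0 := hc0.
case: (@Order.TotalTheory.arg_maxP _ _ _ (res c0)
  (fun r : 'I_n => p (r : nat)%:Z != q (r : nat)%:Z)
  (fun r : 'I_n => q (r : nat)%:Z - (r : nat)%:Z) hr0) => r hr rmax.
pose a : int := (r : nat)%:Z.
have amax c : p c != q c -> q c - c <= q a - a.
  move=> /hres/rmax h; apply: le_trans h.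
  by rewrite {1 2}(res_divE c) qperM //; lia.
(* A point of [q] counted here has a displacement exceeding [q a - a], so [p] and [q] agree on
   it. *)
have M0 : M (a - 1) (q a + 1) = 0.
  apply/eqP; rewrite eq_le M_ge0 andbT subr_le0; apply: ler_sum => s _.
  rewrite /pos /term; have [->//|hs] :=
    eqVneq (p (s : nat)%:Z) (q (s : nat)%:Z).
  have := amax _ hs.
  set u := floorn (a - 1 - _); set v := floorn (q _ - _).
  have := floornP (a - 1 - (s : nat)%:Z) u; rewrite -/u.
  have := floornP (q (s : nat)%:Z - (q a + 1)) v; rewrite -/v.
  set w := floorn _; nia.
have pa : p a < q a.
  have := M_ge0 a (q a + 1); rewrite M_step M0.
  by move: hr; rewrite -/a; lia.
have [b [b1 b2 b3 b4]] := column_rectangle pa M0.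
have [a' [b' [hR hmin]]] : exists a' b',
    rectangle a' b' /\ ~ (a' + n%:Z < b' /\ p a' + n%:Z < p b').
  apply: (@rectangle_minimal a b); split=> //; first by rewrite cong_sym.
    by case/andP: b3.
  by move=> i j hi hj; apply: b4 => //; lia.
by have [r1 r2 r3 r4] := hR; exists a', b'; split=> //;
  apply: ncount_comp_swapz_le.
Qed.

End Raise.

Lemma ncount_le_comp_swapz p a b i j : qper p -> ~~ cong a b -> a < b ->
  p a < p b ->
  ncount p i j <= ncount (p \o swapz a b) i j.
Proof.
move=> hp hab ab pab; rewrite ncount_comp_swapz //.
have h1 := floornP (i - a) (floorn (i - b));
  have h2 := floornP (i - b) (floorn (i - b)).
have h3 := floornP (p b - j) (floorn (p a - j));
  have h4 := floornP (p a - j) (floorn (p a - j)).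
rewrite /pos; lia.
Qed.

Lemma ncount_lt_comp_swapz p a b : qper p -> ~~ cong a b -> a < b ->
  p a < p b ->
  ncount p a (p b) < ncount (p \o swapz a b) a (p b).
Proof.
move=> hp hab ab pab; rewrite ncount_comp_swapz // !subrr.
have f0 : floorn 0 = 0 by rewrite /floorn div0z.
have h1 : floorn (a - b) < 0 by rewrite ltNge floornP; lia.
have h2 : floorn (p a - p b) < 0 by rewrite ltNge floornP; lia.
rewrite f0 /pos; lia.
Qed.

(** Induction on the total gap [S q - S p]: each raise increases [S p], strictly because of the
    corner [(a, p b)], and keeps it at most [S q]. *)
Lemma raise_ind q (P : (int -> int) -> Prop) : qper q ->
  (forall p, p =1 q -> P p) ->
  (forall p a b, qper p -> ~~ cong a b -> a < b -> p a < p b ->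
    P (p \o swapz a b) -> P p) ->
  forall p, qper p -> (forall i j, ncount p i j <= ncount q i j) ->
    (forall i j, lcount p i j = lcount q i j) -> P p.
Proof.
move=> hq P0 PS; have [B hB] := ncount_far q.
(* Up to translation by [n] it is enough to sum over [|j - i| <= |B|]: outside this window the
   counts of [p] and [q] agree, so no raise can have its corner there. *)
pose N := (`|B| + `|B|).+1%N.
pose S p : int := \sum_(k < N) \sum_(r < n)
  ncount p (r : nat)%:Z ((r : nat)%:Z + (k : nat)%:Z - `|B|%:Z).
have S_le p p' : (forall i j, ncount p i j <= ncount p' i j) -> S p <= S p'.
  by move=> h; apply: ler_sum => k _; apply: ler_sum => r _; apply: h.
have S_lt p a b : qper p -> ~~ cong a b -> a < b -> p a < p b ->
    (forall i j, ncount (p \o swapz a b) i j <= ncount q i j) ->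
    (forall i j, lcount p i j = lcount q i j) -> S p < S (p \o swapz a b).
  move=> hp cab ab pab hE hL.
  have hlt := ncount_lt_comp_swapz hp cab ab pab.
  have [hk0 hk] : 0 <= p b - a + `|B|%:Z /\ (`|(p b - a + `|B|%:Z)%R| < N)%N.
    have [h1 h2] := hB a (p b); have := hE a (p b);
      have := lcount_le_ncount p a (p b).
    have := ncount_ge0 p a (p b); rewrite hL /N.
    by have [/h1|] := lerP B (a - p b); have [/h2|] := lerP (a - p b) (- B);
      lia.
  rewrite -subr_gt0 /S -sumrB (bigD1 (Ordinal hk)) //= ltr_wpDr //.
    apply: sumr_ge0 => k _; rewrite -sumrB; apply: sumr_ge0 => r _.
    by rewrite subr_ge0; apply: ncount_le_comp_swapz.
  rewrite -sumrB (bigD1 (res a)) //= ltr_wpDr //.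
    by apply: sumr_ge0 => r _; rewrite subr_ge0; apply: ncount_le_comp_swapz.
  rewrite subr_gt0; have ha := res_divE a.
  have -> : (res a : nat)%:Z = a + (- floorn a) * n%:Z by lia.
  have -> : a + (- floorn a) * n%:Z + `|(p b - a + `|B|%:Z)%R|%N%:Z - `|B|%:Z
    = p b + (- floorn a) * n%:Z by lia.
  by rewrite !ncount_shiftM.
suff H (l : nat) p : S q - S p <= l%:Z -> qper p ->
    (forall i j, ncount p i j <= ncount q i j) ->
      (forall i j, lcount p i j = lcount q i j) -> P p.
  by move=> p; apply: (H `|(S q - S p)%R|%N); lia.
elim: l p => [|l IH] p hS hp hE hL.
all: have [/raise h|h] := EM (exists c, p c <> q c);
  last by apply: P0 => c; apply: contrapT => hc; apply: h; exists c.
all: have [a [b [ab cab pab hE']]] := h hp hq hE hL.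
all: have hlt := S_lt _ _ _ hp cab ab pab hE' hL.
  by have := S_le _ _ hE'; lia.
apply: (PS p a b) => //; apply: IH => //.
- lia.
- exact/qper_comp/qper_swapz.
- by move=> i j; rewrite lcount_comp_swapz.
Qed.

Definition translation (m : int -> int) c : int := c + m c * n%:Z.

Lemma qper_translation (m : int -> int) : periodic m -> qper (translation m).
Proof. by move=> hm c; rewrite /translation hm; lia. Qed.

(** Let [I] consist of the indices whose displacement is at least the smallest one having a positive
    term. Outside [I] no term is positive, and by [te] none inside is negative, so the count of [p]
    is exactly the untruncated sum over [I]; the hypothesis compares this sum with that of the
    translation, which truncation can only increase. *)
Lemma ncount_le_translation p (m : int -> int) : qper p -> periodic m ->
  (forall j I, (forall r s : 'I_n, r \in I ->
      p (r : nat)%:Z - (r : nat)%:Z <= p (s : nat)%:Z - (s : nat)%:Z ->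
        s \in I) ->
    \sum_(r in I) (floorn (p (r : nat)%:Z - j) - floorn ((r : nat)%:Z - j)) <=
      \sum_(r in I) m (r : nat)%:Z) ->
  forall i j, ncount p i j <= ncount (translation m) i j.
Proof.
move=> hp hm hI i j.
pose e (r : 'I_n) := p (r : nat)%:Z - (r : nat)%:Z.
pose t (r : 'I_n) := term p i j (r : nat)%:Z.
(* A term exceeds [(i - j + displacement) / n] by at most 1 and falls short of it by less than 1; by
   integrality a smaller displacement can give a term larger by 1 at most. *)
have te r s : e r <= e s -> t r - 1 <= t s.
  rewrite /e /t /term => h.
  set u := floorn (i - (s : nat)%:Z); set v := floorn (p (s : nat)%:Z - j).
  set u' := floorn (i - (r : nat)%:Z); set v' := floorn (p (r : nat)%:Z - j).
  have h1 := floornP (i - (s : nat)%:Z) (u + 1).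
  have h2 := floornP (p (s : nat)%:Z - j) (v + 1).
  have h3 := floornP (i - (r : nat)%:Z) u';
    have h4 := floornP (p (r : nat)%:Z - j) v'.
  rewrite -/u -/v -/u' -/v' in h1 h2 h3 h4.
  nia.
have [r0 hr0|h0] := pickP (fun r => 0 < t r); last first.
  rewrite /ncount big1 => [|r _]; first exact: ncount_ge0.
  by have := h0 r; rewrite /pos -/(t r); lia.
case: (@Order.TotalTheory.arg_minP _ _ _ r0 (fun r => 0 < t r) e hr0) =>
  r hr rmin.
pose I := [set s | e r <= e s].
have -> : ncount p i j = \sum_(s in I) t s.
  rewrite /ncount (bigID (mem I)) /= [X in _ + X]big1 ?addr0 => [|s].
    by apply: eq_bigr => s; rewrite inE /pos => /te; rewrite -/(t s); lia.
  rewrite inE => hs; have := rmin s; rewrite /pos -/(t s); lia.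
apply: (@le_trans _ _ (\sum_(s in I) term (translation m) i j (s : nat)%:Z)).
  rewrite -subr_ge0 -sumrB.
  have := hI j I; rewrite -subr_ge0 -sumrB => h.
  have -> : \sum_(s in I) (term (translation m) i j (s : nat)%:Z - t s) =
    \sum_(s in I) (m (s : nat)%:Z - (floorn (p (s :
      nat)%:Z - j) - floorn ((s : nat)%:Z - j))).
    apply: eq_bigr => s _; rewrite /t /term /translation.
    by rewrite [_ + _ * n%:Z - j]addrAC floornMD; ring.
  by apply: h => s s'; rewrite !inE; apply: le_trans.
rewrite /ncount [leRHS](bigID (mem I)) /= -[leLHS]addr0 lerD //.
  by apply: ler_sum => s _; rewrite /pos; lia.
by apply: sumr_ge0 => s _; rewrite /pos; lia.
Qed.

End AffinePermutation.

Local Open Scope classical_set_scope.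
Local Open Scope ring_scope.

(** * Root data *)

Section Pairing.
Variable D : rootDatum.
Implicit Types (a b : chars D) (x y : cochars D).

Lemma pairing0l x : pairing (0 : chars D) x = 0.
Proof. by have := pairingDl (0 : chars D) 0 x; rewrite addr0; lia. Qed.

Lemma pairing0r a : pairing a (0 : cochars D) = 0.
Proof. by have := pairingDr a (0 : cochars D) 0; rewrite addr0; lia. Qed.

Lemma pairingNl a x : pairing (- a) x = - pairing a x.
Proof. by have := pairingDl a (- a) x; rewrite subrr pairing0l; lia. Qed.

Lemma pairingNr a x : pairing a (- x) = - pairing a x.
Proof. by have := pairingDr a x (- x); rewrite subrr pairing0r; lia. Qed.

Lemma pairingBl a b x : pairing (a - b) x = pairing a x - pairing b x.
Proof. by rewrite pairingDl pairingNl. Qed.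

Lemma pairingBr a x y : pairing a (x - y) = pairing a x - pairing a y.
Proof. by rewrite pairingDr pairingNr. Qed.

Lemma pairingZl a x k : pairing (a *~ k) x = pairing a x * k.
Proof.
have H (l : nat) c : pairing (c *+ l) x = pairing c x * l%:Z.
  elim: l => [|l IH]; first by rewrite mulr0n pairing0l mulr0.
  by rewrite mulrS pairingDl IH; lia.
by case: k => l; rewrite ?NegzE ?mulrNz ?pairingNl -?pmulrn H; lia.
Qed.

Lemma pairingZr a x k : pairing a (x *~ k) = pairing a x * k.
Proof.
have H (l : nat) y : pairing a (y *+ l) = pairing a y * l%:Z.
  elim: l => [|l IH]; first by rewrite mulr0n pairing0r mulr0.
  by rewrite mulrS pairingDr IH; lia.
by case: k => l; rewrite ?NegzE ?mulrNz ?pairingNr -?pmulrn H; lia.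
Qed.

Lemma pairing_suml (I : Type) (r : seq I) (P : pred I) (F : I -> chars D) x :
  pairing (\sum_(i <- r | P i) F i) x = \sum_(i <- r | P i) pairing (F i) x.
Proof.
by apply: (big_morph (fun a => pairing a x)) => [a b|];
  rewrite ?pairingDl ?pairing0l.
Qed.

Lemma pairing_sumr (I : Type) (r : seq I) (P : pred I) (F : I -> cochars D) a :
  pairing a (\sum_(i <- r | P i) F i) = \sum_(i <- r | P i) pairing a (F i).
Proof. by apply: big_morph => [x y|]; rewrite ?pairingDr ?pairing0r. Qed.

Lemma roots_opp a : a \in (roots D) -> - a \in (roots D).
Proof.
move=> ha; have := roots_stable ha ha; rewrite pairing_coroot //.
by rewrite -[2]/(1 + 1) mulrzDr mulr1z opprD addNKr.
Qed.

End Pairing.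

Section RealPairing.
Variables (R : realType) (D : rootDatum).
Implicit Types (a b : chars D) (x y : cochars D) (v u : coV R D).

Lemma cocoordP x : x = \sum_i @cobasis D i *~ cocoord x i.
Proof. by rewrite /cocoord; case: cid => c [/= h _]. Qed.

Lemma cocoord_uniq x (c : {ffun 'I_(rk D) -> int}) :
  x = \sum_i @cobasis D i *~ c i -> cocoord x = c.
Proof. by rewrite /cocoord; case: cid => c' [/= _ h] /h. Qed.

Lemma inclD x y : incl R (x + y) = incl R x + incl R y.
Proof.
apply/matrixP => i j; rewrite !mxE -intrD; congr _%:~R.
rewrite (@cocoord_uniq (x + y) [ffun i => cocoord x i + cocoord y i]) ?ffunE //.
rewrite {1}(cocoordP x) {1}(cocoordP y) -big_split.
by apply: eq_bigr => k _; rewrite ffunE mulrzDr.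
Qed.

Lemma incl0 : incl R (0 : cochars D) = 0.
Proof. by apply: (addrI (incl R (0 : cochars D))); rewrite -inclD !addr0. Qed.

Lemma inclN x : incl R (- x) = - incl R x.
Proof. by apply/eqP; rewrite -subr_eq0 opprK -inclD addNr incl0. Qed.

Lemma inclB x y : incl R (x - y) = incl R x - incl R y.
Proof. by rewrite inclD inclN. Qed.

Lemma inclZ x k : incl R (x *~ k) = k%:~R *: incl R x.
Proof.
have H (l : nat) y : incl R (y *+ l) = l%:R *: incl R y.
  elim: l => [|l IH]; first by rewrite mulr0n incl0 scale0r.
  by rewrite mulrS inclD IH -[l.+1]add1n natrD scalerDl scale1r.
by case: k => l; rewrite ?NegzE ?mulrNz ?inclN -?pmulrn H // ?mulrNz ?scaleNr.
Qed.

Lemma pairingR_incl a x : pairingR a (incl R x) = (pairing a x)%:~R.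
Proof.
rewrite [in RHS](cocoordP x) pairing_sumr /pairingR rmorph_sum.
by apply: eq_bigr => i _; rewrite mxE pairingZr /= intrM.
Qed.

Lemma pairingRDr a v u : pairingR a (v + u) = pairingR a v + pairingR a u.
Proof. by rewrite /pairingR -big_split; apply: eq_bigr => i _;
  rewrite mxE mulrDr. Qed.

Lemma pairingRZr a k v : pairingR a (k *: v) = k * pairingR a v.
Proof. by rewrite /pairingR mulr_sumr; apply: eq_bigr => i _;
  rewrite mxE mulrCA. Qed.

Lemma pairingR0r a : pairingR a (0 : coV R D) = 0.
Proof. by rewrite -(scale0r 0) pairingRZr mul0r. Qed.

Lemma pairingRNr a v : pairingR a (- v) = - pairingR a v.
Proof. by rewrite -scaleN1r pairingRZr mulN1r. Qed.

Lemma pairingRBr a v u : pairingR a (v - u) = pairingR a v - pairingR a u.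
Proof. by rewrite pairingRDr pairingRNr. Qed.

Lemma pairingRDl a b v : pairingR (a + b) v = pairingR a v + pairingR b v.
Proof.
by rewrite /pairingR -big_split; apply: eq_bigr => i _;
  rewrite pairingDl intrD mulrDl.
Qed.

Lemma pairingR0l v : pairingR (0 : chars D) v = 0.
Proof. by rewrite /pairingR big1 // => i _; rewrite pairing0l mul0r. Qed.

Lemma pairingRNl a v : pairingR (- a) v = - pairingR a v.
Proof.
by rewrite /pairingR -sumrN; apply: eq_bigr => i _;
  rewrite pairingNl mulrNz mulNr.
Qed.

Lemma pairingRBl a b v : pairingR (a - b) v = pairingR a v - pairingR b v.
Proof. by rewrite pairingRDl pairingRNl. Qed.

Lemma pairingR_sumr (I : Type) (r : seq I) (P : pred I) (F : I -> coV R D) a :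
  pairingR a (\sum_(i <- r | P i) F i) = \sum_(i <- r | P i) pairingR a (F i).
Proof. by apply: big_morph => [u v|]; rewrite ?pairingRDr ?pairingR0r. Qed.

End RealPairing.

(* The quadratic form [N x] and its polar map [P] are invariant under the Weyl
   group, and [2 P a = N a a^\vee] for every root [a]; hence coroots are
   transported by reflections. *)
Section CorootReflection.
Variables (R : realType) (D : rootDatum).
Implicit Types (a b c : chars D) (x y : cochars D).

Let srefl a b := b - a *~ pairing b (coroot a).
Let scorefl a x := x - coroot a *~ pairing a x.

Let pairing_refl a b x : pairing (srefl a b) x = pairing b (scorefl a x).
Proof. by rewrite pairingBl pairingBr pairingZl pairingZr mulrC. Qed.

Let coreflK a x : a \in roots D -> scorefl a (scorefl a x) = x.
Proof.
move=> ha; rewrite {1}/scorefl -pairing_refl /srefl pairing_coroot //.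
rewrite -[2]/(1 + 1) mulrzDr mulr1z opprD addNKr pairingNl mulrNz opprK.
by rewrite /scorefl subrK.
Qed.

Let N b : int := \sum_(c <- roots D) pairing b (coroot c) ^+ 2.
Let P b : coV R D :=
  \sum_(c <- roots D) (pairing b (coroot c))%:~R *: incl R (coroot c).

Let corefl_root a : a \in roots D -> exists f : chars D -> chars D,
  perm_eq [seq f c | c <- roots D] (roots D) /\
  forall c, c \in roots D -> coroot (f c) = scorefl a (coroot c).
Proof.
move=> ha.
have /choice[f hf] : forall c, exists d, c \in roots D ->
    d \in roots D /\ coroot d = scorefl a (coroot c).
  move=> c; have [hc|hc] := boolP (c \in roots D); last by exists c.
  by have [d hd e] := coroots_stable ha hc; exists d.
exists f; split=> [|c /hf[]//].
have fI : {in roots D &, injective f}.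
  move=> c d hc hd e; apply: coroot_inj => //.
  rewrite -(coreflK (coroot c) ha) -(coreflK (coroot d) ha).
  by have [_ <-] := hf c hc; have [_ <-] := hf d hd; rewrite e.
have hs : {subset [seq f c | c <- roots D] <= roots D}.
  by move=> d /mapP[c hc ->]; have [] := hf c hc.
have hu : uniq [seq f c | c <- roots D] by rewrite map_inj_in_uniq ?fset_uniq.
apply: uniq_perm => //; first exact: fset_uniq.
by have [] := uniq_min_size hu hs; rewrite ?size_map.
Qed.

Let N_refl a b : a \in roots D -> N (srefl a b) = N b.
Proof.
move=> ha; have [f [fp fE]] := corefl_root ha.
rewrite /N -[in RHS](perm_big _ fp) big_map /=.
rewrite big_seq [RHS]big_seq; apply: eq_bigr => c hc.
by rewrite pairing_refl fE.
Qed.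

Let P_refl a b : a \in roots D ->
  P (srefl a b) = P b - pairingR a (P b) *: incl R (coroot a).
Proof.
move=> ha; have [f [fp fE]] := corefl_root ha.
rewrite {1}/P -(perm_big _ fp) big_map /= pairingR_sumr scaler_suml -sumrB.
rewrite big_seq [RHS]big_seq; apply: eq_bigr => c hc.
rewrite pairing_refl fE // coreflK // pairingRZr pairingR_incl -scalerA
  -scalerBr.
by rewrite inclB inclZ.
Qed.

Let P_root a : a \in roots D -> 2 *: P a = (N a)%:~R *: incl R (coroot a).
Proof.
move=> ha; have := P_refl a ha; rewrite /srefl pairing_coroot //.
have -> : a - a *~ 2 = - a by rewrite -[2]/(1 + 1) mulrzDr mulr1z opprD addNKr.
have -> : P (- a) = - P a.
  by rewrite /P -sumrN; apply: eq_bigr => c _; rewrite pairingNl mulrNz scaleNr.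
have -> : pairingR a (P a) = (N a)%:~R.
  rewrite /P pairingR_sumr /N rmorph_sum; apply: eq_bigr => c _.
  by rewrite pairingRZr pairingR_incl rmorphXn.
by move=> e; rewrite scaler_nat mulr2n -{2}[P a]opprK e opprB addrC subrK.
Qed.

Lemma coroot_refl a b : a \in roots D -> b \in roots D ->
  incl R (coroot (b - a *~ pairing b (coroot a))) =
    incl R (coroot b) - (pairing a (coroot b))%:~R *: incl R (coroot a).
Proof.
move=> ha hb; have hab : srefl a b \in roots D by apply: roots_stable.
have N_gt0 : (N b)%:~R != 0 :> R.
  rewrite intr_eq0 gt_eqF // /N (big_rem b) //= pairing_coroot //.
  by rewrite ltr_pwDl //; apply: sumr_ge0 => c _; rewrite sqr_ge0.
apply: (scalerI N_gt0); rewrite -{1}(N_refl b ha) -P_root // P_refl //.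
rewrite scalerBr P_root // scalerBr; congr (_ - _).
rewrite !scalerA -pairingRZr P_root // pairingRZr pairingR_incl.
done.
Qed.

End CorootReflection.

(** * Closures and convex hulls in V *)

Section Topology.
Variables (R : realType) (D : rootDatum).
Local Notation V := (coV R D).

Lemma pairingR_continuous (a : chars D) : continuous (pairingR a : V -> R).
Proof.
apply: (continuous_big (op := +%R)); first exact: add_continuous.
move=> i _ v; exact: (@cvgMl_tmp _ _ (nbhs v) _ _ _ _ (@coord_continuous R _ _
  i 0 v)).
Qed.

Lemma closure_pairingR_ge (a : chars D) (k : R) (X : set V) v :
  (forall u, X u -> k <= pairingR a u) -> closure X v -> k <= pairingR a v.
Proof.
move=> h hv.
have hc : closed [set u : V | k <= pairingR a u].
  apply: (@preimage_closed _ _ (pairingR a : V ->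
    R) [set x | k <= x]) => [u _|].
    exact: pairingR_continuous.
  exact: closed_ge.
have /closure_id := hc => e.
have : closure [set u : V | k <= pairingR a u] v by apply:
  closure_subset hv => u /h.
by rewrite -e.
Qed.

Lemma closure_segment (X : set V) v u :
  (forall e : R, 0 < e -> e <= 1 -> X (v + e *: u)) -> closure X v.
Proof.
move=> h B hB.
have hf : (fun e : R => v + e *: u) @ (0 : R) --> v + 0 *: u.
  by apply: cvgD; [exact: cvg_cst|apply: cvgZr_tmp; exact: cvg_id].
rewrite scale0r addr0 in hf.
have [e /= e0 he] := hf _ hB.
exists (v + (Num.min (e / 2) 1) *: u); split.
  by apply: h; rewrite ?ge_min ?lexx ?orbT // lt_min divr_gt0 // ltr01.
apply: he; rewrite /ball_ /= sub0r normrN gtr0_norm ?lt_min ?divr_gt0 ?ltr01 //.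
by rewrite gt_min ltr_pdivrMr // ltr_pMr // ltr1n.
Qed.

Lemma convex_setP (X : set V) : @convex_set R V X <->
  forall x y (t : R), 0 <= t <= 1 -> X x -> X y -> X (t *: x + (1 - t) *: y).
Proof.
split=> [h x y t ht hx hy|h x y t /set_mem hx /set_mem hy].
  have := h x y (Itv01 (andP ht).1 (andP ht).2).
  rewrite !inE => /(_ hx hy); exact.
by apply/mem_set/h => //; apply/andP; split.
Qed.

Lemma refl_comb (a : chars D) (t : R) (x y : V) :
  refl a 0 (t *: x + (1 - t) *: y) = t *: refl a 0 x + (1 - t) *: refl a 0 y.
Proof.
move: (1 - t) => s; rewrite /refl !subr0 pairingRDr !pairingRZr scalerDl.
by rewrite !scalerBr -!scalerA opprD addrACA.
Qed.

Lemma Conv_orbit mu (v : V) : W0_orbit R mu v -> Conv R mu v.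
Proof. by move=> h X [_]; apply. Qed.

Lemma Conv_sub mu (X : set V) : (forall x y (t : R), 0 <= t <= 1 ->
    X x -> X y -> X (t *: x + (1 - t) *: y)) ->
  (forall v, W0_orbit R mu v -> X v) -> forall v, Conv R mu v -> X v.
Proof. by move=> /convex_setP hX hO v; apply; split. Qed.

Lemma Conv_segment mu (x y : V) (t : R) : 0 <= t <= 1 ->
  Conv R mu x -> Conv R mu y -> Conv R mu (t *: x + (1 - t) *: y).
Proof.
move=> ht hx hy X [hX hO]; have /convex_setP := hX; apply=> //.
  by apply: hx; split.
by apply: hy; split.
Qed.

Lemma Conv_refl mu (a : chars D) (v : V) : a \in roots D ->
  Conv R mu v -> Conv R mu (refl a 0 v).
Proof.
move=> ha; apply: (Conv_sub (X := fun v => Conv R mu (refl a 0 v))).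
  by move=> x y t ht hx hy; rewrite refl_comb; apply: Conv_segment.
move=> _ [w hw ->]; apply: Conv_orbit; exists (refl a 0 \o w) => //.
by apply: gen_comp => //; apply: gen_in; exists a.
Qed.

End Topology.

(** * Roots and coroots in type A *)

Lemma sum_delta (m t : nat) (F : nat -> int) :
  \sum_(l < m) F l * (l == t :> nat)%:Z = if (t < m)%N then F t else 0.
Proof.
case: ltnP => h.
  rewrite (bigD1 (Ordinal h)) //= eqxx mulr1 big1 ?addr0 // => l.
  by rewrite -val_eqE /= => /negPf ->; rewrite mulr0.
rewrite big1 // => l _; rewrite (_ : (l == t :> nat) = false) ?mulr0 //.
by have := ltn_ord l; lia.
Qed.

Section SimpleRoots.
Variables (D : rootDatum) (Pi : {fset chars D}) (hi : chars D) (m : nat).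
Variable (s : 'I_m -> chars D).
Hypotheses (D_reduced : reduced D) (Pi_base : is_base Pi).
Hypothesis hi_highest : is_highest_root Pi hi.
Hypotheses (m_gt0 : (0 < m)%N) (s_inj : injective s).
Hypothesis sP : forall a, a \in Pi <-> exists i, a = s i.
Hypothesis cartan : forall i j, pairing (s i) (coroot (s j)) =
  if i == j then 2
  else if (i.+1 == j :> nat) || (j.+1 == i :> nat) then -1 else 0.

Definition simple (k : nat) : chars D := if insub k is Some i then s i else 0.

Lemma simple_ord (i : 'I_m) : simple i = s i.
Proof. by rewrite /simple valK. Qed.

Lemma simple_root k : (k < m)%N -> simple k \in roots D.
Proof.
move=> h; rewrite -[k]/(val (Ordinal h)) simple_ord.
by have [+ _ _] := Pi_base; apply; apply/sP; exists (Ordinal h).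
Qed.

Lemma simple_cartan k l : (k < m)%N -> (l < m)%N ->
  pairing (simple k) (coroot (simple l)) =
    2 * (k == l)%:Z - (k.+1 == l)%:Z - (k == l.+1)%:Z.
Proof.
move=> hk hl; have := cartan (Ordinal hk) (Ordinal hl).
rewrite -!simple_ord -val_eqE /= => ->.
by rewrite [k == l.+1]eq_sym; case: (k =P l); case: (k.+1 =P l);
  case: (l.+1 =P k) => /=; lia.
Qed.

(* In the coordinates [e_0, ..., e_m] of the weights of the standard
   representation, [cumul r] is [e_r - e_0]. *)
Definition cumul (r : nat) : chars D := \sum_(k < r) simple k.

Lemma cumulS r : cumul r.+1 = cumul r + simple r.
Proof. by rewrite /cumul big_ord_recr. Qed.

Lemma cumul0 : cumul 0 = 0.
Proof. by rewrite /cumul big_ord0. Qed.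

Lemma pairing_cumul j k : (j <= m)%N -> (k < m)%N ->
  pairing (cumul j) (coroot (simple k)) =
    (j == k.+1)%:Z - (j == k)%:Z + (k == 0)%:Z.
Proof.
elim: j => [|j IH] hj hk; first by rewrite cumul0 pairing0l; lia.
by rewrite cumulS pairingDl IH ?simple_cartan //; lia.
Qed.

Lemma pairing_diff i j k : (i <= m)%N -> (j <= m)%N -> (k < m)%N ->
  pairing (cumul j - cumul i) (coroot (simple k)) =
    (j == k.+1)%:Z - (j == k)%:Z - (i == k.+1)%:Z + (i == k)%:Z.
Proof. by move=> hi' hj hk; rewrite pairingBl !pairing_cumul //; lia. Qed.

Lemma diff_root i j : (i <= m)%N -> (j <= m)%N -> i != j ->
  cumul j - cumul i \in roots D.
Proof.
wlog h : i j / (i < j)%N => [H|].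
  move=> h1 h2 h3; have [h|h] : (i < j)%N \/ (j < i)%N by lia.
    exact: H.
  by rewrite -opprB roots_opp // H // eq_sym.
move=> _ + _; elim: j h => [//|j IH] h hj.
have [e|hij] : i = j \/ (i < j)%N by lia.
  by rewrite e cumulS addrAC subrr add0r simple_root.
have hr := IH hij (ltnW hj); have := roots_stable (simple_root hj) hr.
rewrite pairing_diff; try lia.
have -> : (j == j.+1)%:Z - (j == j)%:Z - (i == j.+1)%:Z + (i == j)%:Z =
  -1 :> int.
  lia.
by rewrite mulrN1z opprK cumulS addrAC.
Qed.

Lemma big_Pi (V : nmodType) (F : chars D -> V) :
  \sum_(b <- Pi) F b = \sum_(k < m) F (s k).
Proof.
have hp : perm_eq (enum_fset Pi) [seq s i | i <- enum 'I_m].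
  apply: uniq_perm; first exact: fset_uniq.
    by rewrite map_inj_uniq ?enum_uniq.
  move=> a; apply/idP/mapP => [/sP[i ->]|[i _ ->]].
    by exists i; rewrite ?mem_enum.
  by apply/sP; exists i.
by rewrite (perm_big _ hp) big_map big_enum.
Qed.

Lemma simple_free (d : nat -> int) :
  \sum_(k < m) simple k *~ d k = 0 -> forall k, (k < m)%N -> d k = 0.
Proof.
move=> h k hk; have [_ hb _] := Pi_base.
pose c b : int := \sum_(i < m | s i == b) d i.
have cE i : c (s i) = d i.
  by rewrite /c (big_pred1 i) // => j /=; rewrite inj_eq.
rewrite -[k]/(val (Ordinal hk)) -cE; apply: hb; last first.
  by apply/sP; exists (Ordinal hk).
rewrite big_Pi -[RHS]h; apply: eq_bigr => i _.
by rewrite cE simple_ord.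
Qed.

Lemma NcombP a : Ncomb Pi a -> exists c : nat -> nat,
  a = \sum_(k < m) simple k *~ (c k)%:Z.
Proof.
move=> [c ->]; exists (fun k => c (simple k)); rewrite big_Pi.
by apply: eq_bigr => k _; rewrite simple_ord -pmulrn.
Qed.

Lemma simple_inj_coeff (c d : nat -> int) :
  \sum_(k < m) simple k *~ c k = \sum_(k < m) simple k *~ d k ->
  forall k, (k < m)%N -> c k = d k.
Proof.
move=> h k hk; apply/eqP; rewrite -subr_eq0.
apply/eqP; apply: (simple_free (d := fun k => c k - d k)) hk.
rewrite -[RHS](subrr (\sum_(k < m) simple k *~ c k)) [in X in _ = _ - X]h.
by rewrite -sumrB; apply: eq_bigr => l _; rewrite mulrzBr.
Qed.

Definition adj_swap k j : nat :=
  if j == k then k.+1 else if j == k.+1 then k else j.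

Lemma cumul_adj_swap k j :
  cumul (adj_swap k j) =
    cumul j - simple k *~ ((j == k.+1)%:Z - (j == k)%:Z).
Proof.
rewrite /adj_swap; case: eqVneq => [->|h1].
  rewrite cumulS (_ : (k == k.+1) = false); last by lia.
  by rewrite mulrN1z opprK.
by case: eqVneq => [->|h2]; rewrite ?cumulS subr0 ?mulr1z ?addrK // mulr0z
  subr0.
Qed.

Lemma refl_diff i j k : (i <= m)%N -> (j <= m)%N -> (k < m)%N ->
  cumul j - cumul i
    - simple k *~ pairing (cumul j - cumul i) (coroot (simple k)) =
  cumul (adj_swap k j) - cumul (adj_swap k i).
Proof.
move=> h1 h2 h3; rewrite pairing_diff // !cumul_adj_swap.
set x := (j == k.+1)%:Z - (j == k)%:Z; set y := (i == k.+1)%:Z - (i == k)%:Z.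
have -> : x - (i == k.+1)%:Z + (i == k)%:Z = x - y by rewrite /y; lia.
by rewrite mulrzBr !opprB [_ *~ y - _]addrC addrACA [- _ + _]addrC.
Qed.

(** Induction on the height. At the first index [k] where the coefficient is maximal, the pairing
    with the simple coroot is positive, as the left neighbour is strictly smaller or absent.
    Reflecting in [simple k] lowers the height; another positive coefficient survives and keeps the
    root positive, unless the root is a multiple of [simple k], where [D_reduced] concludes.
    Reflecting back swaps [k] and [k + 1] in the indices. *)
Lemma positive_root_diff a : a \in roots D -> Ncomb Pi a ->
  exists i j, [/\ (i <= m)%N, (j <= m)%N, i != j & a = cumul j - cumul i].
Proof.
move=> ha /NcombP[c ac].
have [h hc] : exists h, (\sum_(k < m) c k <= h)%N by exists (\sum_(k < m) c
  k)%N.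
elim: h a c ha ac hc => [|h IH] a c ha ac hc.
  have := pairing_coroot ha; rewrite [X in pairing X _]ac big1 ?pairing0l // =>
    k _.
  by move: hc; rewrite (bigD1 k) //=; case: (c k) => // _; rewrite mulr0z.
pose M := (\max_(k < m) c k)%N.
have m_card : (0 < #|'I_m|)%N by rewrite card_ord.
have [k0 k0M] := bigop.eq_bigmax (fun k : 'I_m => c k) m_card;
  rewrite -/M in k0M.
have exk : exists k, (k < m)%N && (c k == M) by exists k0;
  rewrite ltn_ord k0M eqxx.
case: (ex_minnP exk) => k /andP[km /eqP ckM] kmin.
have cM l : (l < m)%N -> (c l <= M)%N.
  by move=> hl; apply: (@bigop.leq_bigmax _ (fun l : 'I_m => c l) (Ordinal hl)).
pose d l : int := if (l < m)%N then (c l)%:Z else 0.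
have x_eq : pairing a (coroot (simple k)) =
    2 * (c k)%:Z - d k.+1 - (if k is k'.+1 then d k' else 0).
  rewrite ac pairing_suml.
  transitivity (\sum_(l < m) ((2 * (c l)%:Z) * (l == k :> nat)%:Z
     - (c l)%:Z * (l == k.+1 :> nat)%:Z - (c l)%:Z * (l.+1 == k :> nat)%:Z)).
    by apply: eq_bigr => l _; rewrite pairingZl simple_cartan //; lia.
  rewrite !sumrB (sum_delta _ _ (fun l => 2 * (c l)%:Z)) km.
  rewrite (sum_delta _ _ (fun l => (c l)%:Z)) -/(d _); congr (_ - _).
  case: k km {kmin ckM exk} => [|k] km; first by rewrite big1 // => l _;
    rewrite mulr0.
  by rewrite (sum_delta _ _ (fun l => (c l)%:Z)).
have M_gt0 : (0 < M)%N.
  rewrite lt0n; apply/eqP => M0.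
  have := pairing_coroot ha; rewrite [X in pairing X _]ac big1 ?pairing0l // =>
    l _.
  by have := cM l (ltn_ord l); rewrite M0 leqn0 => /eqP ->; rewrite mulr0z.
have dM l : d l <= M%:Z by rewrite /d; case: ifP => [/cM|]; lia.
have x_gt0 : 0 < pairing a (coroot (simple k)).
  rewrite x_eq ckM; have := dM k.+1.
  case: k km ckM kmin {exk x_eq} => [|k] km ckM kmin; first by lia.
  have := cM k (ltnW km); rewrite /d (ltnW km).
  by have := kmin k; rewrite (ltnW km) /=; case: eqP => // [_ /(_ isT)|]; lia.
have hk := simple_root km; set x := pairing a _ in x_gt0.
have hb : a - simple k *~ x \in roots D by apply: roots_stable.
pose e l : int := (c l)%:Z - (l == k)%:Z * x.
have be : a - simple k *~ x = \sum_(l < m) simple l *~ e l.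
  rewrite [in LHS]ac /e; under [RHS]eq_bigr do rewrite mulrzBr.
  rewrite sumrB; congr (_ - _).
  rewrite (bigD1 (Ordinal km)) //= eqxx mul1r big1 ?addr0 // => l.
  by rewrite -val_eqE /= => /negPf ->; rewrite mul0r mulr0z.
have [/existsP[l /andP[lk cl]]|/existsPn hl] :=
    boolP [exists l : 'I_m, (l != k :> nat) && (0 < c l)%N]; last first.
  have ek : a *~ 1 = simple k *~ (c k)%:Z.
    rewrite mulr1z ac (bigD1 (Ordinal km)) //= big1 ?addr0 // => l.
    rewrite -val_eqE /= => lk; have := hl l; rewrite lk /= -leqNgt leqn0.
    by move=> /eqP ->; rewrite mulr0z.
  have : simple k = cumul k.+1 - cumul k by rewrite cumulS addrAC subrr add0r.
  have [//|e1|e1] := D_reduced ha hk _ ek => e2.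
    by exists k, k.+1; split; try lia; rewrite -e2 e1.
  by exists k.+1, k; split; try lia; rewrite -opprB -e2 e1 opprK.
have [_ _ /(_ _ hb)[]] := Pi_base; last first.
  move=> /NcombP[c']; rewrite be -sumrN => e2.
  have := @simple_inj_coeff (fun l => - e l) c' _ l (ltn_ord l).
  rewrite -e2 /e (negPf lk); under eq_bigr do rewrite mulrNz.
  by move=> /(_ erefl); lia.
move=> hN; have [c' e2] := NcombP hN.
have ec l' : (l' < m)%N -> e l' = c' l'.
  by apply: (@simple_inj_coeff e (fun l => (c' l)%:Z)); rewrite -be.
have [|i [j [h1 h2 h3 h4]]] := IH _ _ hb e2.
  rewrite -ltnS; apply: leq_trans hc.
  rewrite (bigD1 (Ordinal km)) //= [in ltnRHS](bigD1 (Ordinal km)) //= -addSn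
    leq_add //.
    by have := ec k km; rewrite /e eqxx; lia.
  apply: leq_sum => l'; rewrite -val_eqE /= => h'.
  by have := ec l' (ltn_ord l'); rewrite /e (negPf h'); lia.
have ea : a = cumul (adj_swap k j) - cumul (adj_swap k i).
  rewrite -refl_diff // -h4 pairingBl pairingZl pairing_coroot // -/x.
  have -> : x - 2 * x = - x by lia.
  by rewrite mulrNz opprK subrK.
exists (adj_swap k i), (adj_swap k j); split=> //.
- by rewrite /adj_swap; case: ifP; [|case: ifP]; lia.
- by rewrite /adj_swap; case: ifP; [|case: ifP]; lia.
- rewrite /adj_swap; case: (i =P k); case: (i =P k.+1);
    case: (j =P k); case: (j =P k.+1); lia.
Qed.

Lemma root_diff a : a \in roots D ->
  exists i j, [/\ (i <= m)%N, (j <= m)%N, i != j & a = cumul j - cumul i].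
Proof.
move=> ha; have [_ _ /(_ _ ha)[]] := Pi_base; first exact: positive_root_diff.
move=> /positive_root_diff[|i [j [h1 h2 h3 h4]]]; first exact: roots_opp.
by exists j, i; rewrite eq_sym; split=> //; rewrite -opprB -h4 opprK.
Qed.

Lemma cumul_diffE i j : (i <= m)%N -> (j <= m)%N ->
  cumul j - cumul i =
    \sum_(k < m) simple k *~ ((k < j)%:Z - (k < i)%:Z).
Proof.
have H r : (r <= m)%N -> cumul r = \sum_(k < m) simple k *~ (k < r)%:Z.
  move=> hr; rewrite /cumul (big_ord_widen _ simple hr) big_mkcond.
  by apply: eq_bigr => k _; case: ifP.
move=> hi' hj; rewrite !H // -sumrB; apply: eq_bigr => k _.
by rewrite mulrzBr.
Qed.

Lemma highest_root : hi = cumul m.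
Proof.
have [[hhi _] hmax] := hi_highest.
have hm : positive_root Pi (cumul m).
  split; first by rewrite -[cumul m]subr0 -cumul0 diff_root //; lia.
  exists (fun=> 1%N); rewrite big_Pi; apply: eq_bigr => k _.
  by rewrite mulr1n simple_ord.
have [i [j [h1 h2 _ e]]] := root_diff hhi.
have /NcombP[c] := hmax _ hm.
have -> : hi - cumul m = \sum_(k < m) simple k *~ ((k < j)%:Z - (k < i)%:Z - 1).
  have hm0 : cumul m = cumul m - cumul 0 by rewrite cumul0 subr0.
  rewrite e hm0 !cumul_diffE // -sumrB.
  by apply: eq_bigr => k _; rewrite -mulrzBr ltn_ord subr0.
move=> hE; have hc := @simple_inj_coeff
  (fun k => (k < j)%:Z - (k < i)%:Z - 1) (fun k => (c k)%:Z) hE.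
(* The coefficients of the first and last simple roots force [i = 0] and [j = m]. *)
have e0 := hc _ m_gt0; have em := hc m.-1 ltac:(lia).
have -> : cumul m = cumul m - cumul 0 by rewrite cumul0 subr0.
by rewrite e; congr (cumul _ - cumul _); lia.
Qed.

Section RealCoroots.
Variable R : realType.

Definition cocumul (r : nat) : coV R D :=
  \sum_(k < r) incl R (coroot (simple k)).

Lemma cocumulS r : cocumul r.+1 = cocumul r + incl R (coroot (simple r)).
Proof. by rewrite /cocumul big_ord_recr. Qed.

Lemma cocumul0 : cocumul 0 = 0.
Proof. by rewrite /cocumul big_ord0. Qed.

(** The right-hand side is the standard scalar product of [e_i - e_0] and [e_j - e_0]. *)
Lemma pairing_cumul_cocumul i j : (i <= m)%N -> (j <= m)%N ->
  pairingR (cumul i) (cocumul j) =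
    ((i == j)%:Z + 1 - (i == 0)%:Z - (j == 0)%:Z)%:~R.
Proof.
move=> h1; elim: j => [|j IH] h2.
  by rewrite cocumul0 pairingR0r -[0 in LHS](mulr0z 1); congr _%:~R; lia.
rewrite cocumulS pairingRDr IH ?(ltnW h2) // pairingR_incl pairing_cumul //.
by rewrite -intrD; congr _%:~R; lia.
Qed.

(** The axioms only make the set of coroots stable; the sign comes from [coroot_refl], with [a]
    reflected in itself. *)
Lemma coroot_opp a : a \in roots D ->
  incl R (coroot (- a)) = - incl R (coroot a).
Proof.
move=> ha; have := coroot_refl R ha ha; rewrite !pairing_coroot //.
have -> : a - a *~ 2 = - a by rewrite -[2]/(1 + 1) mulrzDr mulr1z opprD addNKr.
by move=> ->; rewrite -[2]/(1 + 1) intrD scalerDl scale1r opprD addNKr.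
Qed.

Lemma coroot_diff i j : (i <= m)%N -> (j <= m)%N -> i != j ->
  incl R (coroot (cumul j - cumul i)) = cocumul j - cocumul i.
Proof.
wlog h : i j / (i < j)%N => [H|].
  move=> h1 h2 h3; have [h|h] : (i < j)%N \/ (j < i)%N by lia.
    exact: H.
  by rewrite -opprB coroot_opp ?diff_root // 1?eq_sym // H 1?eq_sym // opprB.
move=> h1 + _; elim: j h => [//|j IH] h hj.
have [e|hij] : i = j \/ (i < j)%N by lia.
  by rewrite e cumulS cocumulS addrAC subrr add0r addrAC subrr add0r.
have hr : cumul j - cumul i \in roots D by rewrite diff_root //; lia.
have := coroot_refl R (simple_root hj) hr.
rewrite pairing_diff; try lia.
have -> : (j == j.+1)%:Z - (j == j)%:Z - (i == j.+1)%:Z + (i == j)%:Z =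
  -1 by lia.
have -> : pairing (simple j) (coroot (cumul j - cumul i)) = -1.
  apply: (@intr_inj R); rewrite -pairingR_incl IH ?(ltnW hj) //.
  have -> : simple j = cumul j.+1 - cumul j by rewrite cumulS addrAC subrr
    add0r.
  rewrite pairingRBl !pairingRBr !pairing_cumul_cocumul; try lia.
  by rewrite -!intrB; congr _%:~R; lia.
rewrite mulrN1z opprK IH ?(ltnW hj) // scaleN1r opprK => e.
by rewrite cumulS cocumulS addrAC [in RHS]addrAC -e.
Qed.

End RealCoroots.

End SimpleRoots.

(** * The affine Weyl group and the Bruhat order *)

(** With [t] the least value of [h] on [I], the truncation [f] of [h - t] at 0 vanishes off [I]. Its
    total sum is invariant under [rho] and bounds the sum of [h - t] over any rearrangement of
    [I]. *)
Lemma sum_perm_le (T : finType) (I : {set T}) (rho : {perm T}) (h : T -> int) :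
  (forall r s, r \in I -> s \notin I -> h s <= h r) ->
  \sum_(r in I) h (rho r) <= \sum_(r in I) h r.
Proof.
move=> hI; have [->|/set0Pn[r0 hr0]] := eqVneq I finset.set0.
  by rewrite !big_set0.
case: (@Order.TotalTheory.arg_minP _ _ _ r0 (mem I) h hr0) => r1 hr1 rmin.
pose t := h r1; pose f x := Num.max 0 (h x - t).
have fI x : x \in I -> f x = h x - t by rewrite /f => /rmin; rewrite -/t; lia.
have f0 x : x \notin I -> f x = 0 by rewrite /f => /(hI _ _ hr1); rewrite -/t;
  lia.
have sumE g : \sum_(r in I) g r =
  \sum_(r in I) (g r - t) + \sum_(r in I) t :> int.
  by rewrite -big_split; apply: eq_bigr => r _ /=; rewrite subrK.
rewrite sumE [leRHS]sumE lerD2r.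
have -> : \sum_(r in I) (h r - t) = \sum_r f r.
  rewrite [RHS](bigID (mem I)) /= [X in _ + X]big1 // addr0.
  by apply: eq_bigr => r /fI.
rewrite [leRHS](reindex_inj (@perm_inj _ rho)) /= [leRHS](bigID (mem I)) /=.
rewrite -[leLHS]addr0 lerD //; last by apply: sumr_ge0 => r _; rewrite /f; lia.
by apply: ler_sum => r _; rewrite /f; lia.
Qed.

(** * Words in involutive generators *)

Section Words.
Variables (T : Type) (S : set (T -> T)).

Lemma word_cat k l w w' : word S k w -> word S l w' -> word S (k + l) (w \o w').
Proof.
elim=> [//|k' s v hs _ IH] hw'; rewrite addSn.
by have := word_cons hs (IH hw'); apply.
Qed.

Lemma word1 s : S s -> word S 1 s.
Proof. by move=> hs; apply: (word_cons hs (word_nil S)). Qed.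

Hypothesis S_invol : forall s, S s -> s \o s = id.

Lemma word_inv k w : word S k w ->
  exists w', [/\ word S k w', w \o w' = id & w' \o w = id].
Proof.
elim=> [|k' s v hs _ [v' [h1 h2 h3]]]; first by exists id; split=> //;
  exact: word_nil.
exists (v' \o s); split; first by rewrite -addn1; apply: word_cat => //;
  apply: word1.
  have -> : (s \o v) \o (v' \o s) = s \o (v \o v') \o s by [].
  by rewrite h2; apply: S_invol.
have -> : (v' \o s) \o (s \o v) = v' \o (s \o s) \o v by [].
by rewrite S_invol.
Qed.

Lemma generated_word w : generated S w -> exists k, word S k w.
Proof.
elim=> [|f hf|f g _ [k hk] _ [l hl]|f g fK gK _ [k hk]].
- by exists 0%N; apply: word_nil.
- by exists 1%N; apply: word1.
- by exists (k + l)%N; apply: word_cat.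
have [f' [h1 h2 h3]] := word_inv hk; exists k.
have -> : g = f' by apply/funext => x;
  rewrite -[LHS](congr1 (@^~ (g x)) h3) /= gK.
by [].
Qed.

Lemma word_generated k w : word S k w -> generated S w.
Proof.
elim=> [|k' s v hs _ IH]; first exact: gen_id.
by apply: gen_comp => //; apply: gen_in.
Qed.

Lemma has_length_ex k w : word S k w -> exists l, has_length S w l.
Proof.
move=> hk; have ex : exists k, `[< word S k w >] by exists k; apply/asboolP.
case: (ex_minnP ex) => l /asboolP hl hmin; exists l; split=> // l' hl'.
by apply: hmin; apply/asboolP.
Qed.

End Words.

Lemma generated_sub (T : Type) (S S' : set (T -> T)) w :
  (forall s, S s -> generated S' s) -> generated S w -> generated S' w.
Proof.
move=> h; elim=> [|f hf|f g _ hf _ hg|f g fK gK _ hf].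
- exact: gen_id.
- exact: h.
- exact: gen_comp.
- exact: gen_inv fK gK hf.
Qed.

(** * Affine coordinates, with [A r] for [e_r - e_0] and [C r] for its dual counterpart *)

Section AffineCoordinates.
Variables (R : realType) (D : rootDatum) (Pi : {fset chars D}) (hi : chars D).
Variables (m : nat) (A : nat -> chars D) (C : nat -> coV R D).
Hypothesis m_gt0 : (0 < m)%N.
Hypotheses (A0 : A 0 = 0) (C0 : C 0 = 0).
Hypothesis A_root : forall i j, (i <= m)%N -> (j <= m)%N -> i != j ->
  A j - A i \in roots D.
Hypothesis rootA : forall a, a \in roots D ->
  exists i j, [/\ (i <= m)%N, (j <= m)%N, i != j & a = A j - A i].
Hypothesis A_C : forall i j, (i <= m)%N -> (j <= m)%N ->
  pairingR (A i) (C j) = ((i == j)%:Z + 1 - (i == 0)%:Z - (j == 0)%:Z)%:~R.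
Hypothesis C_coroot : forall i j, (i <= m)%N -> (j <= m)%N -> i != j ->
  incl R (coroot (A j - A i)) = C j - C i.
Hypothesis PiE : forall a, a \in Pi <-> exists2 k, (k < m)%N & a = A k.+1 - A k.
Hypothesis hiE : hi = A m.

Local Notation n := m.+1.
Local Notation floorn := (floorn n).
Local Notation cong := (cong n).
Local Notation swapz := (swapz n).
Local Notation res := (@res n isT).
Local Notation congP := (@congP n isT _ _).
Local Notation cong_refl := (@cong_refl n isT).
Local Notation cong_sym := (@cong_sym n isT).
Local Notation cong_trans := (@cong_trans n isT _ _ _).
Local Notation V := (coV R D).
Implicit Types (a b c d i j k : int) (u v : V) (r : 'I_n).

(* The coordinates of [v], up to an additive constant, extended to all integers
   by [zc v (c + n) = zc v c + 1], so that the affine reflections act by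
   permuting the indices and the base alcove is the set of [v] such that [zc v]
   is increasing. *)
Definition zc v c : R := (floorn c)%:~R + pairingR (A (res c)) v.

Definition coc c : V := C (res c).

Lemma zcM v c k : zc v (c + k * n%:Z) = zc v c + k%:~R.
Proof. by rewrite /zc floornMD // res_shift intrD addrAC. Qed.

Lemma res_le c : (res c <= m)%N. Proof. by rewrite -ltnS ltn_ord. Qed.

Lemma zc_ord v r : zc v (r : nat)%:Z = pairingR (A r) v.
Proof. by rewrite /zc floorn_ord res_ord add0r. Qed.

Lemma zc_nat v (k : nat) : (k <= m)%N -> zc v k%:Z = pairingR (A k) v.
Proof. by move=> h; rewrite -[k]/(val (Ordinal (h : (k < n)%N))) zc_ord. Qed.

Lemma zc0 v : zc v 0 = 0.
Proof. by rewrite (@zc_nat v 0) // A0 pairingR0l. Qed.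

Lemma coc_shift c k : coc (c + k * n%:Z) = coc c.
Proof. by rewrite /coc res_shift. Qed.

Lemma coc_cong c d : cong c d -> coc c = coc d.
Proof. by case/congP => k ->; rewrite coc_shift. Qed.

Lemma zc_cong v c d : cong c d ->
  exists k, c = d + k * n%:Z /\ zc v c = zc v d + k%:~R.
Proof. by case/congP => k ->; exists k; rewrite zcM. Qed.

Lemma pairing_coc c d : pairingR (A (res c)) (coc d) =
  ((cong c d)%:Z + 1 - (cong c 0)%:Z - (cong d 0)%:Z)%:~R.
Proof.
rewrite A_C ?res_le // -!(@res_eq n isT) -!val_eqE.
have -> : val (res 0) = 0%N by rewrite /= mod0n.
by [].
Qed.

Lemma zc_sub v u c (t : R) :
  zc (v - t *: u) c = zc v c - t * pairingR (A (res c)) u.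
Proof. by rewrite /zc pairingRBr pairingRZr addrA. Qed.

Definition arefl i j v : V := v - (zc v j - zc v i) *: (coc j - coc i).

Lemma arefl_sym i j : arefl i j = arefl j i.
Proof.
apply/funext => v; rewrite /arefl -(opprB (zc v i)) -(opprB (coc i)).
by rewrite scalerN scaleNr opprK.
Qed.

Lemma arefl_shift i j k : arefl (i + k * n%:Z) (j + k * n%:Z) = arefl i j.
Proof.
by apply/funext => v; rewrite /arefl !coc_shift !zcM [zc v i + _]addrC opprD
  addrA addrK.
Qed.

(** The last summand is independent of [c]: it restores the normalization [zc v 0 = 0] when the
    reflection moves the class of 0. *)
Lemma zc_arefl_aux i j v c : ~~ cong i j ->
  zc (arefl i j v) c = zc v (swapz i j c)
    + (zc v j - zc v i) * ((cong j 0)%:Z - (cong i 0)%:Z)%:~R.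
Proof.
move=> hij; rewrite zc_sub pairingRBr !pairing_coc -intrB.
set X := zc v j - zc v i.
have -> : (cong c j)%:Z + 1 - (cong c 0)%:Z - (cong j 0)%:Z -
    ((cong c i)%:Z + 1 - (cong c 0)%:Z - (cong i 0)%:Z) =
    ((cong c j)%:Z - (cong c i)%:Z) - ((cong j 0)%:Z - (cong i 0)%:Z) by lia.
rewrite intrB mulrBr opprB addrCA addrC; congr (_ + _).
rewrite /swapz; have [hj|hj] := boolP (cong c j).
  have -> : cong c i = false.
    by apply: contraNF hij => hi'; rewrite (cong_trans _ hj) // cong_sym.
  have [k [ek ->]] := zc_cong v hj.
  have -> : c + (i - j) = i + k * n%:Z by lia.
  by rewrite zcM /X mulr1; lra.
have [hi'|hi'] := boolP (cong c i); last by rewrite mulr0 subr0.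
have [k [ek ->]] := zc_cong v hi'.
have -> : c + (j - i) = j + k * n%:Z by lia.
by rewrite zcM /X sub0r mulrN1; lra.
Qed.

(** Differences eliminate the common shift of [zc_arefl_aux]; [p] is thereby determined only up to a
    constant. As [p] relabels indices, composition is reversed. *)
Definition rep (p : int -> int) (f : V -> V) : Prop :=
  forall v c d, zc (f v) c - zc (f v) d = zc v (p c) - zc v (p d).

Lemma rep_id : rep id id. Proof. by []. Qed.

Lemma rep_comp p q f g : rep p f -> rep q g -> rep (q \o p) (f \o g).
Proof. by move=> hf hg v c d; rewrite hf hg. Qed.

Lemma rep_arefl i j : ~~ cong i j -> rep (swapz i j) (arefl i j).
Proof. by move=> hij v c d; rewrite !zc_arefl_aux //; lra. Qed.

Lemma arefl_invol i j : ~~ cong i j -> arefl i j \o arefl i j = id.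
Proof.
move=> hij; apply/funext => v /=; rewrite {1}/arefl (rep_arefl hij).
rewrite swapz_r // swapz_l // /arefl -addrA -opprD -scalerDl.
by rewrite subrKA subrr scale0r subr0.
Qed.

(** The dual of [rep_arefl]: the linear part of [arefl i j] relabels the differences of [coc] by
    [swapz i j]. This makes conjugation of reflections a relabelling. *)
Lemma coc_swapz i j c d : ~~ cong i j ->
  coc (swapz i j c) - coc (swapz i j d)
    - pairingR (A (res j) - A (res i)) (coc (swapz i j c) - coc (swapz i j d))
      *: (coc j - coc i) = coc c - coc d.
Proof.
move=> hij; rewrite pairingRBl !pairingRBr !pairing_coc -!intrB.
have H e : coc (swapz i j e) - ((cong j (swapz i j e))%:Z - (cong i (swapz i j
  e))%:Z)%:~R
    *: (coc j - coc i) = coc e.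
  rewrite /swapz; have [hj|hj] := boolP (cong e j).
    have /congP[k ek] := hj; have -> : e + (i - j) = i + k * n%:Z by lia.
    rewrite coc_shift ![cong _ (i + _)]cong_sym.
    have -> : cong (i + k * n%:Z) i by apply/congP; exists k.
    have -> : cong (i + k * n%:Z) j = false.
      apply: contraNF hij => /congP[l el]; apply/congP; exists (l - k); lia.
    rewrite sub0r scaleN1r opprK addrC subrK.
    by apply/esym/coc_cong.
  have [hi'|hi'] := boolP (cong e i).
    have /congP[k ek] := hi'; have -> : e + (j - i) = j + k * n%:Z by lia.
    rewrite coc_shift ![cong _ (j + _)]cong_sym.
    have -> : cong (j + k * n%:Z) j by apply/congP; exists k.
    have -> : cong (j + k * n%:Z) i = false.
      apply: contraNF hij => /congP[l el]; apply/congP; exists (k - l); lia.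
    rewrite subr0 scale1r opprB addrC subrK.
    by apply/esym/coc_cong.
  by rewrite ![cong _ e]cong_sym (negPf hj) (negPf hi') subrr scale0r subr0.
rewrite -(H c) -(H d).
set x := (cong j (swapz i j c))%:Z; set x' := (cong i (swapz i j c))%:Z.
set y := (cong j (swapz i j d))%:Z; set y' := (cong i (swapz i j d))%:Z.
set K := (X in _ - X%:~R *: _ = _).
have -> : K = (x - x') - (y - y') by rewrite /K; lia.
rewrite intrB scalerBl !opprB addrACA [in RHS]addrACA.
by congr (_ + _); apply: addrC.
Qed.

Lemma arefl_conj i j a b : ~~ cong i j ->
  arefl a b \o arefl i j = arefl i j \o arefl (swapz i j a) (swapz i j b).
Proof.
move=> hij; apply/funext => v /=.
rewrite {1}/arefl (rep_arefl hij v b a) /arefl.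
set X := zc v (swapz i j b) - _; set u := coc (swapz i j b) - _.
rewrite -[coc b - coc a](coc_swapz b a hij) -/u.
have -> : zc (v - X *: u) j - zc (v - X *: u) i =
    zc v j - zc v i - X * pairingR (A (res j) - A (res i)) u.
  by rewrite !zc_sub pairingRBl; lra.
move: (coc j - coc i) (pairingR _ u) (zc v j - zc v i) => w t y.
clearbody X u; rewrite scalerBr scalerA scalerBl !opprB.
by rewrite [_ *: w - X *: u]addrC addrACA [- _ + _]addrC.
Qed.


Lemma res_nat (k : nat) : (k <= m)%N -> res k%:Z = k :> nat.
Proof. by move=> h; rewrite -[k in LHS]/(val (Ordinal (h :
  (k < n)%N))) res_ord. Qed.

Lemma cong_nat (k l : nat) : (k <= m)%N -> (l <= m)%N ->
  cong k%:Z l%:Z = (k == l).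
Proof.
by move=> hk hl; rewrite -{2}(res_nat hk) -{2}(res_nat hl) -(@res_eq n isT).
Qed.

Lemma cong_shiftl c d k : cong (c + k * n%:Z) d = cong c d.
Proof. by rewrite -!(@res_eq n isT) res_shift. Qed.

Lemma arefl_refl i j : ~~ cong i j ->
  arefl i j = refl (A (res j) - A (res i)) (floorn i - floorn j).
Proof.
move=> hij; apply/funext => v; rewrite /arefl /refl C_coroot ?res_le //;
  last first.
  by rewrite val_eqE res_eq.
by congr (_ - _ *: _); rewrite /zc pairingRBl intrB; lra.
Qed.

Lemma arefl_root i j : ~~ cong i j -> A (res j) - A (res i) \in roots D.
Proof. by move=> hij; apply: A_root; rewrite ?res_le // val_eqE res_eq. Qed.

Lemma refl_arefl (al : chars D) k : al \in roots D -> exists i j,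
  [/\ i < j, ~~ cong i j & refl al k = arefl i j :> (V -> V)].
Proof.
move=> /rootA[i [j [h1 h2 h3 ->]]].
have hc : ~~ cong (i%:Z + k * n%:Z) j%:Z by rewrite cong_shiftl cong_nat.
have e : refl (A j - A i) k = arefl (i%:Z + k * n%:Z) j%:Z :> (V -> V).
  rewrite arefl_refl // res_shift !res_nat // floornMD //.
  have -> : floorn i%:Z = 0 by have := floorn_ord (Ordinal (h1 : (i < n)%N)).
  have -> : floorn j%:Z = 0 by have := floorn_ord (Ordinal (h2 : (j < n)%N)).
  by rewrite add0r subr0.
have [h|h|h] := ltgtP (i%:Z + k * n%:Z) j%:Z.
- by exists (i%:Z + k * n%:Z), j%:Z.
- by exists j%:Z, (i%:Z + k * n%:Z); rewrite cong_sym arefl_sym.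
- by move: hc; rewrite h cong_refl.
Qed.

Lemma cong_succ i : ~~ cong i (i + 1).
Proof.
apply/congP => -[k e]; have hn : 2 <= n%:Z :> int by have := m_gt0; lia.
have {}e : k * n%:Z = -1 by lia.
by move: hn e; move: (n%:Z) => N hN; have [h|h] := lerP 0 k; nia.
Qed.

Local Notation S := (Saff R Pi hi).

Lemma arefl_simple (k : nat) : (k < m)%N ->
  arefl k%:Z (k%:Z + 1) = refl (A k.+1 - A k) 0.
Proof.
move=> hk; rewrite arefl_refl ?cong_succ //.
have -> : k%:Z + 1 = k.+1%:Z by lia.
rewrite !res_nat ?(ltnW hk) //.
have -> : floorn k%:Z = 0 by have := floorn_ord (Ordinal (ltnW hk : (k < n)%N)).
by have -> : floorn k.+1%:Z = 0 by have :=
  floorn_ord (Ordinal (hk : (k.+1 < n)%N)).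
Qed.

Lemma arefl_highest : arefl m%:Z (m%:Z + 1) = refl hi 1.
Proof.
rewrite arefl_sym arefl_refl 1?cong_sym ?cong_succ //.
have -> : m%:Z + 1 = 0 + 1 * n%:Z by lia.
rewrite res_shift (@res_nat 0) // res_nat // A0 subr0 -hiE floornMD //.
have -> : floorn m%:Z = 0 by have := floorn_ord (@ord_max m).
by have -> : floorn 0 = 0 by have := floorn_ord (@ord0 m).
Qed.

(** Only the class of [i] modulo [n] matters, and [i = m] gives the affine generator since
    [m + 1 = 0 + n]. *)
Lemma SaffP f : S f <-> exists i, f = arefl i (i + 1).
Proof.
split=> [[[a /PiE[k hk ->] ->]|->]|[i ->]].
- by exists k%:Z; rewrite arefl_simple.
- by exists m%:Z; rewrite arefl_highest.
rewrite -(arefl_shift i _ (- floorn i)).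
have -> : i + - floorn i * n%:Z =
  (res i : nat)%:Z by rewrite {1}(@res_divE n isT i); lia.
have -> : i + 1 + - floorn i * n%:Z = (res i : nat)%:Z + 1.
  by rewrite {1}(@res_divE n isT i); lia.
have [h|h] := ltnP (res i) m.
  left; rewrite arefl_simple //; exists (A (res i).+1 - A (res i)) => //.
  by apply/PiE; exists (res i).
by right; rewrite -arefl_highest (_ : (res i : nat) = m) //; have := res_le i;
  lia.
Qed.

(** The coordinate form of the fact that a simple reflection makes no positive affine root negative
    except its own. Each index moves by at most 1, and a collision from [b = a + 2] would need
    [n = 1]. *)
Lemma swapz_lt i a b : ~~ cong a b -> a < b -> ~ (cong a i /\ b = a + 1) ->
  swapz i (i + 1) a < swapz i (i + 1) b.
Proof.
move=> hab ab h; rewrite /swapz.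
have hn : 2 <= n%:Z :> int by have := m_gt0; lia.
have h1 : cong b (i + 1) -> cong a i -> a + 1 < b - 1.
  move=> /congP[k ek] /congP[l el].
  have : b - a = 1 + (k - l) * n%:Z by lia.
  have : ~ (b = a + 1) by move=> e; apply: h; split=> //; apply/congP; exists l.
  move: (k - l) hn => u; move: (n%:Z) => N hN hb hu.
  have hub : u <= -1 \/ u = 0 \/ 1 <= u by lia.
  by case: hub => [hub|[hub|hub]]; [nia|move: hu; rewrite hub mul0r; lia|nia].
have h2 : ~~ cong b (i + 1) -> cong a i -> a + 1 < b.
  move=> hb /congP[l el]; have : b <> a + 1; last by lia.
  by move=> e; move/negP: hb; apply; apply/congP; exists l; lia.
have h3 : cong b (i + 1) -> ~~ cong a i -> a < b - 1.
  move=> /congP[k ek] ha; have : b <> a + 1; last by lia.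
  by move=> e; move/negP: ha; apply; apply/congP; exists k; lia.
have [a1|a1] := boolP (cong a (i + 1)); have [b1|b1] := boolP (cong b (i + 1)).
- by lia.
- by case: ifP => _; lia.
- by move: h1 h3; rewrite b1; case: ifP => ai h1 h3;
  [have := h1 isT isT|have := h3 isT isT]; lia.
by move: h2; rewrite b1; case: ifP => ai h2; [have := h2 isT isT|];
  case: ifP => _; lia.
Qed.

Lemma swapz_invol i j c : ~~ cong i j -> swapz i j (swapz i j c) = c.
Proof.
move=> hij; have hji : cong j i = false by rewrite cong_sym; apply/negbTE.
rewrite {2}/swapz; have [/congP[k ek]|hj] := boolP (cong c j).
  have -> : c + (i - j) = i + k * n%:Z by lia.
  by rewrite /swapz !cong_shiftl (negPf hij) cong_refl; lia.
have [/congP[k ek]|hi'] := boolP (cong c i); last by rewrite swapz_out.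
have -> : c + (j - i) = j + k * n%:Z by lia.
by rewrite /swapz !cong_shiftl cong_refl; lia.
Qed.

Lemma cong_swapz i j c d : ~~ cong i j ->
  cong (swapz i j c) (swapz i j d) = cong c d.
Proof.
move=> hij; have H e e' : cong e e' -> cong (swapz i j e) (swapz i j e').
  by case/congP => k ->; rewrite (@qperM n isT) ?cong_shiftl ?cong_refl //;
    apply: qper_swapz.
by apply/idP/idP => /H //; rewrite !swapz_invol.
Qed.

Lemma arefl_conj2 i j a b : ~~ cong i j ->
  arefl i j \o arefl (swapz i j a) (swapz i j b) \o arefl i j = arefl a b.
Proof.
move=> hij; rewrite -arefl_conj //.
have -> : (arefl a b \o arefl i j) \o arefl i j =
  arefl a b \o (arefl i j \o arefl i j) by [].
by rewrite arefl_invol.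
Qed.

Lemma S_invol s : S s -> s \o s = id.
Proof. by move=> /SaffP[i ->]; rewrite arefl_invol ?cong_succ. Qed.

(** Conjugation by the generator [arefl (j - 1) j] replaces [j] by [j - 1] and does not lower [i],
    hence brings the indices closer until they are adjacent. *)
Lemma arefl_reflection i j : i < j -> ~~ cong i j -> reflection S (arefl i j).
Proof.
have [k hk] : exists k : nat, j - i <= k%:Z by exists `|j - i|%N; lia.
elim: k i j hk => [|k IH] i j hk ij hij; first by lia.
have [e|hj] := eqVneq j (i + 1).
  exists (arefl i j), id, id; split=> //; last exact: gen_id.
  by apply/SaffP; exists i; rewrite e.
have hs := cong_succ (j - 1); rewrite subrK in hs.
have hlt : swapz (j - 1) j i < swapz (j - 1) j j.
  have := @swapz_lt (j - 1) i j hij ij; rewrite subrK; apply.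
  by case=> _ e; move: hj; rewrite e eqxx.
have hle : swapz (j - 1) j j - swapz (j - 1) j i <= k%:Z.
  rewrite swapz_r // /swapz (negPf hij); case: ifP => _; lia.
have hc : ~~ cong (swapz (j - 1) j i) (swapz (j - 1) j j) by rewrite cong_swapz.
have [s [w [w' [h1 h2 h3 h4 h5]]]] := IH _ _ hle hlt hc.
have Sj : S (arefl (j - 1) j) by apply/SaffP; exists (j - 1); rewrite subrK.
have jK v : arefl (j - 1) j (arefl (j - 1) j v) = v.
  exact: (congr1 (@^~ v) (arefl_invol hs)).
exists s, (arefl (j - 1) j \o w), (w' \o arefl (j - 1) j); split=> //.
- by apply: gen_comp => //; apply: gen_in.
- by move=> v /=; rewrite jK h3.
- by move=> v /=; rewrite h4 jK.
by rewrite -(arefl_conj2 i j hs) h5.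
Qed.

Lemma reflection_generated t : reflection S t -> generated S t.
Proof.
move=> [s [w [w' [h1 h2 h3 h4 ->]]]]; apply: gen_comp;
  last exact: gen_inv h3 h4 h2.
by apply: gen_comp => //; apply: gen_in.
Qed.

Lemma Waff_word w : Waff R D w -> exists l, word S l w.
Proof.
move=> hw; apply: (generated_word S_invol); apply: generated_sub hw.
move=> _ [a ha [k ->]]; have [i [j [ij hij ->]]] := refl_arefl k ha.
exact/reflection_generated/arefl_reflection.
Qed.

Lemma arefl_Waff i j : ~~ cong i j -> Waff R D (arefl i j).
Proof.
move=> hij; apply: gen_in; rewrite /= arefl_refl //.
by exists (A (res j) - A (res i));
  [exact: arefl_root|exists (floorn i - floorn j)].
Qed.

Lemma word_Waff (k : nat) w : word S k w -> Waff R D w.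
Proof.
move=> hw; apply: generated_sub (word_generated hw) => _ /SaffP[i ->].
exact/arefl_Waff/cong_succ.
Qed.

Lemma reflection_arefl t : reflection S t -> exists i j,
  [/\ i < j, ~~ cong i j & t = arefl i j].
Proof.
suff H : reflection S t -> exists i j, ~~ cong i j /\ t = arefl i j.
  move=> /H[i [j [hij ->]]]; have [h|h|h] := ltgtP i j.
  - by exists i, j.
  - by exists j, i; rewrite cong_sym arefl_sym.
  - by move: hij; rewrite h cong_refl.
move=> [s [w [w' [/SaffP[i ->] /(generated_word S_invol)[k hk] wK w'K ->]]]].
have := cong_succ i; move: (i + 1) => j.
elim: hk w' i j wK w'K => [|k' s' v /SaffP[l ->] _ IH] w' i j wK w'K hij.
  by exists i, j; split=> //; apply/funext => u /=; rewrite [w' u](wK u).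
have hl := cong_succ l; have lK u : arefl l (l + 1) (arefl l (l + 1) u) = u.
  exact: (congr1 (@^~ u) (arefl_invol hl)).
have [||c [d [hcd e]]] := IH (w' \o arefl l (l + 1)) i j _ _ hij.
- by move=> u /=; rewrite (wK u).
- by move=> u; rewrite -[LHS]lK /= [arefl _ _ (v _)]w'K lK.
exists (swapz l (l + 1) c), (swapz l (l + 1) d); rewrite cong_swapz //;
  split=> //.
rewrite -(arefl_conj2 (swapz l (l + 1) c) (swapz l (l + 1) d) hl) !swapz_invol
  // -e.
by apply/funext => u /=; rewrite lK.
Qed.

(** * Strong exchange, and Bruhat steps as crossings of hyperplanes *)

Definition increasing (f : int -> R) : Prop := forall c d, c < d -> f c < f d.

(** The hypothesis on [w v0] says that the hyperplane of [arefl a b] separates [w(A_0)] from [A_0].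
    If it is the wall of the first letter, that letter is deleted; otherwise the reflection is
    conjugated past it, and by [swapz_lt] the new pair is still in order and separating for the rest
    of the word. *)
Lemma strong_exchange v0 (k : nat) w : increasing (zc v0) -> word S k w ->
  forall a b, ~~ cong a b -> a < b -> zc (w v0) b < zc (w v0) a ->
  exists2 l, (l < k)%N & word S l (arefl a b \o w).
Proof.
move=> h0; elim=> [|k' s v hs hv IH] a b hab ab /=.
  by move=> h; have := lt_trans h (h0 _ _ ab); rewrite ltxx.
have /SaffP[i es] := hs; have hi1 := cong_succ i.
have [[ai eb]|hne] := EM (cong a i /\ b = a + 1).
  move=> _; exists k' => //; have /congP[l el] := ai.
  have -> : arefl a b = s by rewrite es eb el addrAC arefl_shift.
  have -> : s \o (s \o v) = (s \o s) \o v by [].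
  by rewrite S_invol.
rewrite -subr_gt0 es (rep_arefl hi1) subr_gt0 => hlt.
have [|l hl hw] := IH (swapz i (i + 1) a) (swapz i (i + 1) b) _ (swapz_lt hab
  ab hne) hlt.
  by rewrite cong_swapz.
exists l.+1 => //.
have -> : arefl a b \o (arefl i (i + 1) \o v) =
  (arefl a b \o arefl i (i + 1)) \o v by [].
by rewrite arefl_conj //; apply: (word_cons _ hw); rewrite -es.
Qed.

(** The hyperplane separates the image of [A_0] under [arefl a b \o w] from [A_0], so exchange in a
    reduced word of that element gives a shorter word of [w]. *)
Lemma bruhat_step_up v0 w a b : increasing (zc v0) -> Waff R D w ->
  ~~ cong a b -> a < b -> zc (w v0) a < zc (w v0) b ->
  bruhat_step S w (arefl a b \o w).
Proof.
move=> h0 /Waff_word[k hw] hab ab h.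
have rabK : arefl a b \o (arefl a b \o w) = w.
  by rewrite -[RHS]/(id \o w) -(arefl_invol hab).
have [l0 hy] : exists l, word S l (arefl a b \o w).
  by apply/Waff_word/gen_comp; [exact: arefl_Waff|exact: word_Waff hw].
have [l [hl lmin]] := has_length_ex hy; have [k' [hk kmin]] := has_length_ex hw.
exists (arefl a b), k', l; split=> //; first exact: arefl_reflection.
have [|l' h1] := strong_exchange h0 hl hab ab.
  by rewrite /= -subr_gt0 (rep_arefl hab) swapz_l // swapz_r // subr_gt0.
by rewrite rabK => /kmin h2; apply: leq_ltn_trans h1.
Qed.

Lemma bruhat_step_down v0 x y : increasing (zc v0) -> bruhat_step S x y ->
  exists i j, [/\ i < j, ~~ cong i j, y = arefl i j \o x &
    zc (y v0) j <= zc (y v0) i].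
Proof.
move=> h0 [t [k [l [/reflection_arefl[i [j [ij hij ->]]] ey hx hy kl]]]].
exists i, j; split=> //; rewrite leNgt; apply/negP => h.
have [hxw _] := hx; have [|k' k'k hw] := strong_exchange h0 hxw hij ij.
  move: h; rewrite -subr_gt0 ey /= (rep_arefl hij) swapz_l // swapz_r //.
  by rewrite subr_gt0.
have [_ /(_ k')] := hy; rewrite ey => /(_ hw); lia.
Qed.

(** [rep] leaves a constant free in [p]; the clause on [lcount] records that this [p] is a product
    of swaps, without a global shift. *)
Lemma word_rep (k : nat) w : word S k w -> exists p, [/\ rep p w, qper n p &
  forall q i j, qper n q -> lcount n (q \o p) i j = lcount n q i j].
Proof.
elim=> [|k' s v /SaffP[i ->] _ [p [h1 h2 h3]]].
  by exists id; split=> //; exact: rep_id.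
exists (p \o swapz i (i + 1)); split.
- by apply: rep_comp => //; apply/rep_arefl/cong_succ.
- by apply: qper_comp => //; apply: qper_swapz.
move=> q a b hq; rewrite -(h3 q) //.
by rewrite -(@lcount_comp_swapz n isT _ _ _ _ _ (qper_comp hq h2) (cong_succ
  i)).
Qed.


Lemma word_rep_Waff w : Waff R D w -> exists p, [/\ rep p w, qper n p &
  forall q i j, qper n q -> lcount n (q \o p) i j = lcount n q i j].
Proof. by move=> /Waff_word[k /word_rep]. Qed.

(** * Alcoves, facets and vertices in coordinates *)

Definition nondecreasing (f : int -> R) : Prop :=
  forall c d, c <= d -> f c <= f d.

Lemma zc_diff v c d : zc v d - zc v c =
  pairingR (A (res d) - A (res c)) v + (floorn d - floorn c)%:~R.
Proof. by rewrite /zc pairingRBl intrB; lra. Qed.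

Lemma zcD v u c (t : R) :
  zc (v + t *: u) c = zc v c + t * pairingR (A (res c)) u.
Proof. by rewrite /zc pairingRDr pairingRZr addrA. Qed.

Lemma alcoveP v : base_alcove R Pi hi v <-> increasing (zc v).
Proof.
split=> [[h1 h2]|h].
  have hS c : zc v c < zc v (c + 1).
    rewrite (@res_divE n isT c) addrAC !zcM ltrD2r.
    have [h|h] := ltnP (res c) m.
      have -> : (res c : nat)%:Z + 1 = (res c : nat).+1%:Z by lia.
      rewrite !zc_nat ?(ltnW h) // -subr_gt0 -pairingRBl; apply: h1.
      by apply/PiE; exists (res c).
    have -> : (res c : nat) = m by have := res_le c; lia.
    have -> : m%:Z + 1 = 0 + 1 * n%:Z by lia.
    by rewrite zcM zc0 zc_nat // add0r -hiE.
  move=> c d cd; have [k ->] : exists k : nat, d = c + k.+1%:Z.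
    by exists `|(d - c - 1)%R|%N; lia.
  elim: k {cd d} => [|k IH]; first exact: hS.
  have -> : c + k.+2%:Z = c + k.+1%:Z + 1 by lia.
  exact: lt_trans IH (hS _).
split=> [_ /PiE[k hk ->]|].
  have := h k%:Z k.+1%:Z ltac:(lia).
  by rewrite !zc_nat ?(ltnW hk) // pairingRBl subr_gt0.
have := h m%:Z (0 + 1 * n%:Z) ltac:(lia).
by rewrite zcM zc0 zc_nat // add0r -hiE.
Qed.

(** Subtracting the mean gives coefficients [g] of sum 0. In the combination of the [C r] with these
    coefficients the constant terms of [A_C] cancel, and coordinate [r] becomes [g r - g 0]. *)
Lemma exists_zc (f : int -> R) : (forall c, f (c + n%:Z) = f c + 1) ->
  exists v, forall c, zc v c = f c - f 0.
Proof.
move=> hf; pose avg := (\sum_(r < n) f (r : nat)%:Z) / n%:R.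
pose g (r : 'I_n) := f (r : nat)%:Z - avg.
have g0 : \sum_r g r = 0.
  rewrite sumrB sumr_const card_ord -[avg *+ n]mulr_natr /avg.
  by rewrite divfK ?subrr // pnatr_eq0.
exists (\sum_r g r *: C r) => c.
have hh : periodic n (fun c => f c - (floorn c)%:~R).
  by move=> d /=; rewrite hf floornD // intrD; lra.
have e := @periodic_res n isT _ _ c hh; cbv beta in e;
  rewrite floorn_ord subr0 in e.
have -> : f c = f (res c : nat)%:Z + (floorn c)%:~R by rewrite e; lra.
rewrite /zc pairingR_sumr.
have -> : \sum_(r < n) pairingR (A (res c)) (g r *: C r) =
    \sum_(r < n) (g r * (res c == r)%:R + g r * (1 - (res c == 0 :> nat)%:R)
      - g r * (r == ord0)%:R).
  apply: eq_bigr => r _; have hr : (r <= m)%N by have := ltn_ord r.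
  rewrite pairingRZr A_C ?res_le //.
  rewrite -!val_eqE /= !intrB intrD.
  have bE (b : bool) : b%:Z%:~R = b%:R :> R by case: b.
  by rewrite !bE; ring.
rewrite sumrB big_split /= -mulr_suml g0 mul0r addr0.
rewrite (bigD1 (res c)) //= eqxx mulr1 big1 ?addr0 => [|r]; last first.
  by rewrite eq_sym => /negPf ->; rewrite mulr0.
rewrite (bigD1 ord0) //= mulr1 big1 ?addr0 => [|r]; last first.
  by move=> /negPf ->; rewrite mulr0.
by rewrite /g /=; lra.
Qed.

(** At this point of the base alcove, comparing coordinates amounts to comparing their indices. *)
Lemma exists_barycenter : exists v, forall c, zc v c = c%:~R / n%:R.
Proof.
have [|v hv] := @exists_zc (fun c => c%:~R / n%:R).
  by move=> c; rewrite intrD mulrDl divff ?pnatr_eq0.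
by exists v => c; rewrite hv mul0r subr0.
Qed.

Lemma barycenter_increasing v : (forall c, zc v c = c%:~R / n%:R) ->
  increasing (zc v).
Proof. by move=> h c d cd; rewrite !h ltr_pM2r ?invr_gt0 ?ltr0n // ltr_int. Qed.

Lemma closure_alcove v : closure (base_alcove R Pi hi) v <-> nondecreasing (zc
  v).
Proof.
split=> [hv c d|hv].
  rewrite le_eqVlt => /orP[/eqP -> //|cd].
  rewrite -subr_ge0 zc_diff -lerBlDr sub0r; apply: closure_pairingR_ge hv => u.
  by move=> /alcoveP/(_ _ _ cd); rewrite -subr_gt0 zc_diff; lra.
have [v0 hv0] := exists_barycenter; have h0 := barycenter_increasing hv0.
apply: (closure_segment (u := v0 - v)) => e e0 e1; apply/alcoveP => c d cd.
rewrite !zcD !pairingRBr; have := h0 _ _ cd; have := hv _ _ (ltW cd).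
rewrite /zc; move: (pairingR _ _) (pairingR _ _) (pairingR _ _) (pairingR _ _)
  => x y z t.
move: ((floorn c)%:~R) ((floorn d)%:~R) => k l; nra.
Qed.

Lemma facet_pairingR v u : (forall c, exists k : int, zc v c = k%:~R) ->
  facet v u -> forall i : nat, (i <= m)%N ->
    pairingR (A i) u = pairingR (A i) v.
Proof.
move=> hv hu i hi'; have [->|i0] := eqVneq i 0%N;
  first by rewrite A0 !pairingR0l.
have [k hk] := hv i%:Z; rewrite zc_nat // in hk.
have hr : A i \in roots D by rewrite -[A i]subr0 -A0 A_root // eq_sym.
have := hu _ k hr; rewrite hk subrr sgr0 => /eqP.
by rewrite sgr_eq0 subr_eq0 => /eqP.
Qed.

Lemma zc_eq v u : (forall i : nat, (i <= m)%N ->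
  pairingR (A i) u = pairingR (A i) v) ->
  zc u = zc v.
Proof. by move=> h; apply/funext => c; rewrite /zc h // res_le. Qed.

(** At an integral point every root takes an integral value, so all roots vanish on the directions
    of its facet. Translation along them preserves every facet, hence they belong to the direction
    space of any other one. *)
Lemma vertex_integral v : nondecreasing (zc v) ->
  (forall c, exists k : int, zc v c = k%:~R) -> vertex Pi hi v.
Proof.
move=> hm hv; split=> [u hu|b d e _].
  by apply/closure_alcove; rewrite (zc_eq (facet_pairingR hv hu)).
move=> [x [U [hx _ hU <-]]] [y [W [hy hW _ <-]]]; apply/dimvS/hU => u hu.
have -> : u - x = y + (u - x) - y by rewrite [y + _]addrC addrK.
apply: hW => al k hal.
suff -> : pairingR al (y + (u - x)) = pairingR al y by apply: hy.
have [i [j [h1 h2 _ ->]]] := rootA hal.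
rewrite pairingRDr pairingRBr !pairingRBl.
by rewrite !(facet_pairingR hv hu) // !(facet_pairingR hv hx) // subrr addr0.
Qed.

Lemma vertex_nondecreasing v : vertex Pi hi v -> nondecreasing (zc v).
Proof. by move=> [h _]; apply/closure_alcove/h. Qed.

(** The span of the coroots. When the roots do not span the dual of V, coordinates do not determine
    a point; they do within a translate of this span, and [Waff] preserves such translates. *)
Definition inspan u : Prop := exists x : 'I_m ->
  R, u = \sum_(r < m) x r *: C r.+1.

Lemma inspan0 : inspan 0.
Proof. by exists (fun=> 0); rewrite big1 // => r _; rewrite scale0r. Qed.

Lemma inspanD u v : inspan u -> inspan v -> inspan (u + v).
Proof.
move=> [x ->] [y ->]; exists (fun i : 'I_m => x i + y i); rewrite -big_split.
by apply: eq_bigr => r _; rewrite scalerDl.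
Qed.

Lemma inspanZ (t : R) u : inspan u -> inspan (t *: u).
Proof.
move=> [x ->]; exists (fun i : 'I_m => t * x i); rewrite scaler_sumr.
by apply: eq_bigr => r _; rewrite scalerA.
Qed.

Lemma inspanB u v : inspan u -> inspan v -> inspan (u - v).
Proof. by move=> hu hv; rewrite -scaleN1r; apply: inspanD => //;
  apply: inspanZ. Qed.

Lemma inspan_coc c : inspan (coc c).
Proof.
rewrite /coc; have := ltn_ord (res c); case: (res c : nat) => [|k] hk.
  by rewrite C0; apply: inspan0.
exists (fun i : 'I_m => (i == k :> nat)%:R).
rewrite (bigD1 (Ordinal (hk : (k < m)%N))) //= eqxx scale1r big1 ?addr0 // => r.
by rewrite -val_eqE /= => /negPf ->; rewrite scale0r.
Qed.

Lemma Waff_inspan w v : Waff R D w -> inspan (w v - v).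
Proof.
move=> /Waff_word[k hw]; elim: hw => [|k' s w' /SaffP[i ->] _ IH] /=.
  by rewrite subrr; apply: inspan0.
rewrite {1}/arefl -addrA [- _ - v]addrC addrA.
by apply: inspanB => //; apply/inspanZ/inspanB; apply: inspan_coc.
Qed.

Lemma inspan_eq u v : inspan (u - v) -> zc u = zc v -> u = v.
Proof.
move=> [x hx] huv; apply/eqP; rewrite -subr_eq0 hx; apply/eqP.
have hs (i : 'I_m) : x i + \sum_(r < m) x r = 0.
  have := congr1 (pairingR (A i.+1)) hx;
    rewrite pairingRBr -(zc_nat u) // -(zc_nat v) //.
  rewrite huv subrr pairingR_sumr => h0; rewrite [RHS]h0.
  have -> : x i = \sum_(r < m) x r * (i == r)%:R.
    rewrite (bigD1 i) //= eqxx mulr1 big1 ?addr0 // => r.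
    by rewrite eq_sym => /negPf ->; rewrite mulr0.
  rewrite -big_split; apply: eq_bigr => r _.
  rewrite pairingRZr A_C // eqSS !subr0 -val_eqE intrD mulrDr mulr1.
  by have bE (b : bool) : b%:Z%:~R = b%:R :> R; [case: b|rewrite bE].
have hS : \sum_(r < m) x r = 0.
  have : \sum_(i < m) (x i + \sum_(r < m) x r) = 0 by rewrite big1.
  rewrite big_split /= sumr_const card_ord -mulrS => /eqP.
  by rewrite mulrn_eq0 => /eqP.
rewrite big1 // => r _; have := hs r; rewrite hS addr0 => ->; exact: scale0r.
Qed.

(** * Translations, [W0] and [Omega] acting on indices *)

Definition coeff (l : cochars D) c : int := pairing (A (res c)) l.

Lemma periodic_coeff l : periodic n (coeff l).
Proof. by move=> c; rewrite /coeff -[n%:Z]mul1r res_shift. Qed.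

Lemma zc_transl l v c :
  zc (transl (incl R l) v) c = zc v (translation n (coeff l) c).
Proof. by rewrite /translation zcM /transl /zc pairingRDr pairingR_incl addrA.
  Qed.

Lemma rep_transl l : rep (translation n (coeff l)) (transl (incl R l)).
Proof. by move=> v c d; rewrite !zc_transl. Qed.

Lemma reflE (al : chars D) k v :
  refl al k v = v - (pairingR al v - k%:~R) *: incl R (coroot al).
Proof. by []. Qed.

Let W0gen : set (V -> V) := [set s | exists2 a, a \in roots D & s = refl a 0].

Lemma W0gen_invol s : W0gen s -> s \o s = id.
Proof.
by move=> [al hal ->]; have [i [j [_ hij ->]]] := refl_arefl 0 hal;
  apply: arefl_invol.
Qed.

Lemma W0_word w : W0 R D w -> exists l, word W0gen l w.
Proof. exact: generated_word W0gen_invol _. Qed.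

Lemma W0_Waff w : W0 R D w -> Waff R D w.
Proof.
apply: generated_sub => _ [al hal ->]; apply: gen_in.
by exists al => //; exists 0.
Qed.

Lemma Wext_rep x : Wext R D x -> exists2 p, qper n p & rep p x.
Proof.
move=> [l [w [/W0_Waff/word_rep_Waff[p [h1 h2 _]] ->]]].
exists (p \o translation n (coeff l)).
  by apply: qper_comp => //; apply: qper_translation => //;
    apply: periodic_coeff.
by apply: rep_comp => //; apply: rep_transl.
Qed.

Lemma rep_uniq p p' f : rep p f -> rep p' f ->
  forall c d, p c - p d = p' c - p' d.
Proof.
have [v hv] := exists_barycenter.
move=> h h' c d; apply: (@intr_inj R); have := h v c d; rewrite h' !hv -!mulrBl.
by rewrite -!intrB => /(mulIf _) -> //; rewrite invr_eq0 pnatr_eq0.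
Qed.

Lemma Omega_mono t p : Omega R Pi hi t -> rep p t ->
  forall c d, c < d -> p c < p d.
Proof.
move=> [_ ht] hp c d cd.
have [v hv] := exists_barycenter; have h0 := barycenter_increasing hv.
have : base_alcove R Pi hi (t v) by rewrite -ht; exists v => //; apply/alcoveP.
move=> /alcoveP/(_ _ _ cd); rewrite -subr_gt0 hp subr_gt0 !hv.
by rewrite ltr_pM2r ?invr_gt0 ?ltr0n // ltr_int.
Qed.

Lemma Omega_nondecreasing t v : Omega R Pi hi t ->
  nondecreasing (zc v) -> nondecreasing (zc (t v)).
Proof.
move=> ht hv c d; rewrite le_eqVlt => /orP[/eqP -> //|cd].
have [p _ hp] := Wext_rep ht.1.
by rewrite -subr_ge0 hp subr_ge0; apply/hv/ltW/(Omega_mono ht hp).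
Qed.

Lemma transl_coroot (al : chars D) k : al \in roots D ->
  Waff R D (transl (incl R (coroot al *~ k))).
Proof.
move=> hal.
have -> : transl (incl R (coroot al *~ k)) = refl al k \o refl al 0 :> (V -> V).
  apply/funext => v /=; rewrite !reflE pairingRBr pairingRZr pairingR_incl.
  rewrite pairing_coroot // inclZ /transl subr0 -addrA -opprD -scalerDl.
  congr (_ + _); rewrite -scaleNr; congr (_ *: _).
  by rewrite -[(2 : int)%:~R]/(2 : R); lra.
by apply: gen_comp; apply: gen_in; exists al => //; [exists k|exists 0].
Qed.

Lemma transl_comp (u v : V) : transl u \o transl v = transl (u + v).
Proof. by apply/funext => x; rewrite /transl /= addrAC addrA. Qed.

(** A reflection moves a coweight by a multiple of a coroot, so the translations by the orbit of
    [mu] all have the same component in [Omega]. *)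
Lemma W0_incl w mu : W0 R D w -> exists2 l, w (incl R mu) = incl R l &
  Waff R D (transl (incl R (l - mu))).
Proof.
move=> /W0_word[k hw]; elim: hw => [|k' s w' [al hal ->] _ [l e hl]] /=.
  exists mu => //; rewrite subrr incl0.
  have -> : transl 0 = id :> (V -> V) by apply/funext => v;
    rewrite /transl addr0.
  exact: gen_id.
exists (l - coroot al *~ pairing al l).
  by rewrite e reflE subr0 pairingR_incl inclB inclZ.
have -> : l - coroot al *~ pairing al l - mu =
    coroot al *~ (- pairing al l) + (l - mu) by rewrite addrAC addrC mulrNz.
by rewrite inclD -transl_comp; apply: gen_comp => //; apply: transl_coroot.
Qed.

Lemma Waff_Wext w x : Waff R D w -> Wext R D x -> Wext R D (w \o x).
Proof.
move=> /Waff_word[k hw] hx; elim: hw => [//|k' s w' hs _ IH].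
have : Waff R D s by apply: (word_Waff (word1 hs)).
have /SaffP[i ->] := hs; rewrite arefl_refl ?cong_succ // => _.
have hal := arefl_root (cong_succ i).
set al := A _ - A _ in hal *; move: (floorn i - floorn (i + 1)) => j.
have [l [w0 [hw0 e]]] := IH.
exists (coroot al *~ j + (l - coroot al *~ pairing al l)), (refl al 0 \o w0).
split; first by apply: gen_comp => //; apply: gen_in; exists al.
have -> : (refl al j \o w') \o x = refl al j \o (w' \o x) by [].
rewrite e; apply/funext => v /=; rewrite /transl !reflE inclD inclB !inclZ.
rewrite pairingRDr pairingR_incl subr0.
set c := incl R (coroot al); set y := w0 v.
rewrite !scalerBl scalerDl !opprD opprK.
rewrite -!addrA; congr (_ + _); rewrite [LHS]addrCA; congr (_ + _).
by rewrite addrA [RHS]addrC.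
Qed.


(** * Admissible and permissible elements *)

Definition permutes (w : V -> V) (sg : {perm 'I_n}) : Prop :=
  forall v (r s : 'I_n),
  pairingR (A r) (w v) - pairingR (A s) (w v) =
  pairingR (A (sg r)) v - pairingR (A (sg s)) v.

Lemma permutes_comp w w' sg sg' : permutes w sg -> permutes w' sg' ->
  permutes (w \o w') (sg * sg')%g.
Proof. by move=> h h' v r s; rewrite /= h h' !permM. Qed.

Lemma permutes_refl (i j : 'I_n) : i != j ->
  permutes (refl (A j - A i) 0) (tperm i j).
Proof.
move=> ij v; have hle (r : 'I_n) : (r <= m)%N by have := ltn_ord r.
have H (r : 'I_n) : pairingR (A r) (refl (A j - A i) 0 v) =
    pairingR (A (tperm i j r)) v - (pairingR (A j) v - pairingR (A i) v)
      * ((i == 0 :> nat)%:R - (j == 0 :> nat)%:R).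
  rewrite reflE subr0 C_coroot // pairingRBr pairingRZr pairingRBr !A_C //.
  have bE (b : bool) : b%:Z%:~R = b%:R :> R by case: b.
  rewrite pairingRBl !intrB !intrD !bE.
  case: tpermP => [->|->|/eqP ri /eqP rj].
  - by rewrite eqxx [(i == j :> nat)](negPf ij) /= mulr0n mulr1n; ring.
  - by rewrite eqxx [(j == i :> nat)]eq_sym [(i == j :> nat)](negPf ij) /=
    mulr0n mulr1n; ring.
  - by rewrite [(r == j :> nat)](negPf rj) [(r == i :> nat)](negPf ri) mulr0n;
    ring.
by move=> r s; rewrite !H; ring.
Qed.

Lemma W0_permutes w : W0 R D w -> exists sg, permutes w sg.
Proof.
move=> /W0_word[k]; elim=> [|k' s v [al hal ->] _ [sg h]].
  by exists 1%g => v r s; rewrite !perm1.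
have [i [j [h1 h2 h3 ->]]] := rootA hal.
exists (tperm (Ordinal (h1 : (i < n)%N)) (Ordinal (h2 : (j < n)%N)) * sg)%g.
have hij : Ordinal (h1 : (i < n)%N) != Ordinal (h2 : (j < n)%N) by [].
exact: permutes_comp (permutes_refl hij) h.
Qed.

(** [n] times the sum over [I] of the coordinates, once these are normalized to have total sum 0;
    adding a constant to all coordinates does not change it. *)
Definition level (I : {set 'I_n}) v : R :=
  n%:R * (\sum_(r in I) pairingR (A r) v) - #|I|%:R * (\sum_(r < n) pairingR (A
    r) v).

Lemma level_shift (I : {set 'I_n}) v (f : 'I_n -> R) :
  (forall r s : 'I_n, pairingR (A r) v - pairingR (A s) v = f r - f s) ->
  level I v = n%:R * (\sum_(r in I) f r) - #|I|%:R * (\sum_r f r).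
Proof.
move=> h; have [c e] : exists c : R, forall r : 'I_n, pairingR (A r) v =
  f r + c.
  by exists (pairingR (A (@ord0 m)) v - f ord0) => r; have := h r ord0; lra.
rewrite /level; under eq_bigr do rewrite e.
under [X in _ - _ * X]eq_bigr do rewrite e.
rewrite !big_split /= !sumr_const card_ord !mulrDr.
by rewrite -!(mulr_natl c); ring.
Qed.

Lemma level_comb (I : {set 'I_n}) (t : R) u v :
  level I (t *: u + (1 - t) *: v) = t * level I u + (1 - t) * level I v.
Proof.
rewrite /level; under eq_bigr do rewrite pairingRDr !pairingRZr.
under [X in _ - _ * X]eq_bigr do rewrite pairingRDr !pairingRZr.
by rewrite !big_split /= -!mulr_sumr; ring.
Qed.

(* A point of the orbit of [mu] maximizing the linear form with coefficients [e]
   has its coordinates in the same order as [e]. *)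
Lemma orbit_sorted mu (e : 'I_n -> int) : exists l,
  [/\ W0_orbit R mu (incl R l), Waff R D (transl (incl R (l - mu))) &
    forall I : {set 'I_n}, (forall r s : 'I_n, r \in I -> e r <= e s ->
      s \in I) ->
      forall v, Conv R mu v -> level I v <= level I (incl R l)].
Proof.
pose h (r : 'I_n) := pairing (A r) mu.
pose P (sg : {perm 'I_n}) := `[< exists2 w, W0 R D w & permutes w sg >].
have P1 : P 1%g.
  by apply/asboolP; exists id; [exact: gen_id|move=> v r s; rewrite !perm1].
pose F (sg : {perm 'I_n}) := \sum_r e r * h (sg r).
case: (@Order.TotalTheory.arg_maxP _ _ _ 1%g P F P1) =>
  sg /asboolP[w hw hsg] smax.
have [l el hl] := W0_incl mu hw; exists l.
have level_orbit I w' sg' : permutes w' sg' -> level I (w' (incl R mu)) =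
    n%:R * (\sum_(r in I) h (sg' r))%:~R - #|I|%:R * (\sum_r h r)%:~R.
  move=> hp; rewrite (@level_shift I _ (fun r => (h (sg' r))%:~R)); last first.
    by move=> r s; rewrite hp !pairingR_incl.
  congr (_ * _ - _ * _); first by rewrite rmorph_sum.
  by rewrite rmorph_sum /= [RHS](reindex_inj (@perm_inj _ sg')).
split=> //; first by exists w; rewrite ?el.
move=> I hI; apply: Conv_sub => [x y t ht hx hy|_ [w' hw' ->]].
  by rewrite level_comb; nra.
have [sg' hsg'] := W0_permutes hw'.
rewrite -el !(level_orbit _ _ _ hsg') (level_orbit _ _ _ hsg) lerD2r.
rewrite ler_pM2l ?ltr0n // ler_int.
have -> : \sum_(r in I) h (sg' r) = \sum_(r in I) h (sg ((sg' * sg^-1)%g r)).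
  by apply: eq_bigr => r _; rewrite permM permKV.
apply: (@sum_perm_le _ I _ (fun r => h (sg r))) => r s rI sI.
have ers : e s < e r by rewrite ltNge; apply: contra sI; apply: hI.
have rs : r != s by apply: contraTneq ers => ->; rewrite ltxx.
(* Two values in the wrong order could be exchanged by a reflection, and this would increase the
   maximal [F]. *)
rewrite leNgt; apply/negP => hlt.
have hle (i : 'I_n) : (i <= m)%N by have := ltn_ord i.
have : P (tperm r s * sg)%g.
  apply/asboolP; exists (refl (A s - A r) 0 \o w).
    apply: gen_comp => //; apply: gen_in; exists (A s - A r) => //.
    by apply: A_root; rewrite // ?val_eqE.
  exact: permutes_comp (permutes_refl rs) hsg.
move=> /smax hmax; have : F (tperm r s * sg)%g <= F sg := hmax.
rewrite leNgt => /negP; apply; rewrite /F.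
rewrite (bigD1 r) //= (bigD1 s) 1?eq_sym //= [ltRHS](bigD1 r) //=.
rewrite [X in _ < _ + X](bigD1 s) 1?eq_sym //= !permM tpermL tpermR !addrA.
rewrite [X in _ < _ + X](eq_bigr (fun i : 'I_n => e i * h (sg i))) =>
  [|i /andP[ir is_]].
  by rewrite ltrD2r; nia.
by rewrite permM tpermD // eq_sym.
Qed.

(** The displacement moves along the coroot by [-f], whereas the linear reflection moves it by
    [-(f - g)]. The point [a] and [y] lie on opposite sides, [f <= 0 <= g], so the new displacement
    is between the old one and its image. *)
Lemma Conv_arefl mu i j (a y : V) : nondecreasing (zc a) -> i < j ->
  ~~ cong i j ->
  zc y j <= zc y i -> Conv R mu (y - a) -> Conv R mu (arefl i j y - a).
Proof.
move=> ha ij hij hy hc; have hal := arefl_root hij.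
have haij := ha _ _ (ltW ij).
set al := A (res j) - A (res i) in hal.
have e : pairingR al (y - a) = (zc y j - zc y i) - (zc a j - zc a i).
  by rewrite pairingRBr !zc_diff; lra.
have hr := Conv_refl hal hc; rewrite reflE subr0 e in hr.
rewrite /al C_coroot ?res_le ?val_eqE ?res_eq // -!/(coc _) in hr.
pose f := zc y j - zc y i; pose g := zc a j - zc a i.
rewrite -/f -/g in hr; have hf : f <= 0 by rewrite /f; lra.
have hg : 0 <= g by rewrite /g; lra.
have [fg|fg] := eqVneq (f - g) 0.
  have f0 : f = 0 by lra.
  by rewrite /arefl -/f f0 scale0r subr0.
(* The position on that segment: [t = 0] is the old displacement and [t = 1] its reflection. *)
pose t := f / (f - g).
have ht : 0 <= t <= 1.
  have fg0 : f - g < 0 by rewrite lt_neqAle fg /=; lra.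
  by rewrite /t ler_ndivlMr // ler_ndivrMr // mul0r mul1r; lra.
have := Conv_segment ht hr hc.
have -> : t *: (y - a - (f - g) *: (coc j - coc i)) + (1 - t) *: (y - a) =
    arefl i j y - a; last by [].
rewrite scalerBr scalerA /t divfK // [(1 - _) *:
  _]scalerBl scale1r addrC addrA subrK.
by rewrite /arefl addrAC.
Qed.

Lemma Waff_inv w : Waff R D w ->
  exists h, [/\ Waff R D h, w \o h = id & h \o w = id].
Proof.
move=> /Waff_word[k /(word_inv S_invol)[h [/word_Waff h1 h2 h3]]].
by exists h.
Qed.

Lemma orbit_translate mu l (t w : V -> V) :
  Waff R D (transl (incl R (l - mu))) -> Waff R D w ->
  transl (incl R mu) = w \o t -> exists2 w', Waff R D w' & transl (incl R l) =
    w' \o t.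
Proof.
move=> hl hw e; exists (transl (incl R (l - mu)) \o w); first exact: gen_comp.
rewrite -[RHS]/(transl _ \o (w \o t)) -e transl_comp -inclD.
by rewrite subrK.
Qed.

Lemma transl_opp_Waff l : Waff R D (transl (incl R l)) ->
  Waff R D (transl (incl R (- l))).
Proof.
by apply: gen_inv => v; rewrite /transl inclN; [exact: addrK|exact: subrK].
Qed.

Lemma bruhat_Conv mu (t x y : V -> V) : Omega R Pi hi t -> bruhat S x y ->
  (forall a : V, nondecreasing (zc a) -> Conv R mu (y (t a) - a)) ->
  forall a : V, nondecreasing (zc a) -> Conv R mu (x (t a) - a).
Proof.
have [v0 hv0] := exists_barycenter; have h0 := barycenter_increasing hv0.
move=> ht; elim=> [{}x {}y hxy|//|{}x z {}y _ IH1 _ IH2 hy];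
  last exact: (IH1 (IH2 hy)).
move=> hy a ha; have [_ [_ [l [_ _ _ [hyw _] _]]]] := hxy.
have [i [j [ij hij e hle]]] := bruhat_step_down h0 hxy.
have -> : x = arefl i j \o y.
  by rewrite e -[RHS]/((arefl i j \o arefl i j) \o x) arefl_invol.
apply: Conv_arefl => //; last exact: hy.
have [p [hp _ _]] := word_rep hyw.
have hta := Omega_nondecreasing ht ha.
(* The inequality at [v0] means [p j <= p i], which transfers it to [t a], a point of the closed
   alcove. *)
rewrite -subr_le0 hp subr_le0; apply: hta; rewrite leNgt; apply/negP => /h0.
by rewrite -subr_gt0 -hp subr_gt0 ltNge hle.
Qed.

Lemma Adm_sub_Perm mu x : Adm R Pi hi mu x -> Perm R Pi hi mu x.
Proof.
move=> [hx [_ [w0 hw0 ->] [w [w' [t [hw hw' ht [-> el] hb]]]]]].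
have [l e hl] := W0_incl mu hw0; rewrite e in el.
have hl' : Waff R D (transl (incl R (mu - l))).
  by have := transl_opp_Waff hl; rewrite opprB.
have [w'' hw'' emu] := orbit_translate hl' hw' el.
exists t, w, w''; split=> // a /vertex_nondecreasing;
  apply: (bruhat_Conv ht hb).
move=> {}a _; rewrite -[w' (t a)]/((w' \o t) a) -el /transl addrC addKr.
by apply: Conv_orbit; exists w0.
Qed.

(** The coordinates floor((c - j)/n) are integral and nondecreasing, so [vertex_integral]
    applies. *)
Lemma vertex_exists j : exists v, vertex Pi hi v /\
  forall c d, zc v c - zc v d = (floorn (c - j) - floorn (d - j))%:~R.
Proof.
have [|v hv] := @exists_zc (fun c => (floorn (c - j))%:~R).
  by move=> c; rewrite addrAC floornD // intrD.
have hv2 c d : zc v c - zc v d = (floorn (c - j) - floorn (d - j))%:~R.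
  by rewrite !hv intrB; lra.
exists v; split=> //; apply: vertex_integral => [c d cd|c].
  rewrite !hv lerD2r ler_int floornP //.
  by have := @floornP n isT (c - j) (floorn (c - j)); rewrite lexx; lia.
by exists (floorn (c - j) - floorn (0 - j)); rewrite hv intrB.
Qed.

Lemma Perm_sub_Adm mu x : Perm R Pi hi mu x -> Adm R Pi hi mu x.
Proof.
move=> [t [w [w' [ht [hw' emu] [hw ->] hvert]]]].
have hwt : Wext R D (w \o t) by apply: Waff_Wext => //; exact: ht.1.
split=> //; have [p0 hp0 rp0] := Wext_rep hwt.
(* The order of the displacements does not depend on the constant left free in [p0], so [l] can be
   chosen before the permutation of [x] is normalized. *)
have [l [hl hlmu hlevel]] := orbit_sorted mu (fun r : 'I_n =>
  p0 (r : nat)%:Z - (r : nat)%:Z).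
exists (incl R l) => //; have [w1 hw1 el] := orbit_translate hlmu hw' emu.
have [h [hh hh1 hh2]] : exists h, [/\ Waff R D h, w1 \o h = id & h \o w1 = id].
  exact: Waff_inv.
have et : t = h \o transl (incl R l).
  by rewrite el -[RHS]/((h \o w1) \o t) hh2.
have [ph [rph qph Lph]] := word_rep_Waff hh.
have [pw [rpw qpw Lpw]] := word_rep_Waff hw.
pose q := translation n (coeff l).
have hq : qper n q by apply: qper_translation => //; apply: periodic_coeff.
have rpt : rep (q \o ph) t by rewrite et; apply: rep_comp => //;
  apply: rep_transl.
have hqt : qper n (q \o ph) by apply: qper_comp.
(* The normalized permutation of [x]: it differs from [q] by elements of [Waff], whence [hLin]. *)
pose p := (q \o ph) \o pw.
have rp : rep p (w \o t) by apply: rep_comp.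
have hp : qper n p by apply: qper_comp.
have hLin i j : lcount n p i j = lcount n q i j by rewrite Lpw // Lph.
have hE : forall i j, ncount n p i j <= ncount n q i j.
  apply: ncount_le_translation => // [|j I hI]; first exact: periodic_coeff.
  have hI' : forall r s : 'I_n, r \in I ->
      p0 (r : nat)%:Z - (r : nat)%:Z <= p0 (s : nat)%:Z - (s : nat)%:Z ->
        s \in I.
    move=> r s hr hrs; apply: hI hr _.
    by have := rep_uniq rp rp0 (r : nat)%:Z (s : nat)%:Z; lia.
  have [v [hv hvz]] := vertex_exists j.
  pose f (r : 'I_n) := floorn (p (r : nat)%:Z - j) - floorn ((r : nat)%:Z - j).
  pose g (r : 'I_n) := coeff l (r : nat)%:Z.
  have := hlevel I hI' _ (hvert _ hv).
  rewrite (@level_shift I _ (fun r => (f r)%:~R)); last first.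
    move=> r s; rewrite !pairingRBr -!zc_ord.
    have := rp v (r : nat)%:Z (s : nat)%:Z;
      have := hvz (r : nat)%:Z (s : nat)%:Z.
    have := hvz (p (r : nat)%:Z) (p (s : nat)%:Z).
    by rewrite /f !intrB; lra.
  rewrite (@level_shift I _ (fun r => (g r)%:~R)); last first.
    by move=> r s; rewrite !pairingR_incl /g /coeff !res_ord.
  (* [lcount p = lcount q] equates the total sums, so the inequality of levels reduces to the sums
     over [I]. *)
  have -> : \sum_r (f r)%:~R = \sum_r (g r)%:~R :> R.
    rewrite -!rmorph_sum; congr _%:~R.
    have /eqP := hLin 0 j; rewrite -subr_eq0 -sumrB => /eqP hL0.
    apply/eqP; rewrite -subr_eq0 -sumrB; apply/eqP; rewrite -[RHS]hL0.
    apply: eq_bigr => r _.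
    have qr : floorn (q (r : nat)%:Z - j) = floorn ((r : nat)%:Z - j) + g r.
      by rewrite /q /translation addrAC floornMD.
    by rewrite /f /term qr; ring.
  rewrite lerD2r ler_pM2l ?ltr0n // -!rmorph_sum.
  by rewrite ler_int.
(* The factor [q \o ph] of [t] stays fixed and only the [Waff] part [pu] is raised, as the extended
   order compares elements with the same [t]. *)
pose Q (p' : int -> int) := forall (u : V -> V) pu, Waff R D u ->
  rep pu u -> p' = (q \o ph) \o pu ->
  exists2 u', Waff R D u' & bruhat S u u' /\ u' \o t = transl (incl R l).
suff : Q p.
  move=> /(_ w pw hw rpw erefl)[u' hu' [hb e']].
  by exists w, u', t; split.
apply: (@raise_ind n isT q Q hq _ _ p hp hE hLin) => [p' e' u pu hu ru ep'|].
  exists u => //; split; first exact: rt_refl.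
  (* Equal coordinates suffice, since both sides differ from [t v] by a vector in the span of the
     coroots. *)
  apply/funext => v; apply: inspan_eq.
    rewrite el /=.
    have -> : u (t v) - w1 (t v) = (u (t v) - t v) - (w1 (t v) - t v).
      by rewrite opprB addrA subrK.
    by apply: inspanB; apply: Waff_inspan.
  apply/funext => c; have : rep p' (u \o t) by rewrite ep'; apply: rep_comp.
  move=> /(_ v c 0); rewrite !zc0 subr0 e' e' => ->.
  by rewrite -rep_transl zc0 subr0.
move=> p' a b hp' hab ab hpab IH u pu hu ru ep'.
have [v0 hv0] := exists_barycenter; have h0 := barycenter_increasing hv0.
have [|||u' hu' [hb e']] := IH (arefl a b \o u) (pu \o swapz a b).
- by apply: gen_comp => //; apply: arefl_Waff.
- by apply: rep_comp => //; apply: rep_arefl.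
- by rewrite ep'.
exists u' => //; split=> //; apply: rt_trans hb; apply: rt_step.
apply: (bruhat_step_up h0) => //.
rewrite -subr_gt0 ru subr_gt0; apply: h0.
(* [q \o ph] represents [t] in [Omega] and is increasing, so [p' a < p' b] gives [pu a < pu b]. *)
rewrite ltNge; apply/negP; rewrite le_eqVlt => /orP[/eqP eab|].
  by move: hpab; rewrite ep' /= eab ltxx.
move=> /(Omega_mono ht rpt); move: hpab; rewrite ep' /= => h1 h2.
by have := lt_trans h1 h2; rewrite ltxx.
Qed.

End AffineCoordinates.

Theorem theorem1 (R : realType) (n : nat) (D : rootDatum)
    (Pi : {fset chars D}) (hi : chars D) (mu : cochars D)
    (n_gt1 : (1 < n)%N)
    (D_reduced : reduced D) (D_irreducible : irreducible D)
    (Pi_base : is_base Pi) (hi_highest : is_highest_root Pi hi)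
    (D_typeA : type_A Pi n.-1) (mu_dominant : dominant Pi mu) :
  Adm R Pi hi mu = Perm R Pi hi mu.
Proof.
have m_gt0 : (0 < n.-1)%N by case: n n_gt1 {D_typeA} => [|[]].
move: n.-1 D_typeA m_gt0 => m [s [s_inj sP cartan]] m_gt0.
have A_root := diff_root Pi_base m_gt0 sP cartan.
have rootA := root_diff D_reduced Pi_base m_gt0 s_inj sP cartan.
have A_C := pairing_cumul_cocumul m_gt0 cartan R.
have C_coroot := coroot_diff Pi_base m_gt0 sP cartan R.
have hiE := highest_root D_reduced Pi_base hi_highest m_gt0 s_inj sP cartan.
have PiE a : a \in Pi <-> exists2 k, (k < m)%N & a = cumul s k.+1 - cumul s k.
  split=> [/sP[i ->]|[k hk ->]].
    by exists i; rewrite // cumulS addrAC subrr add0r simple_ord.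
  apply/sP; exists (Ordinal hk).
  by rewrite cumulS addrAC subrr add0r -simple_ord.
apply/seteqP; split=> x.
  exact: (Adm_sub_Perm m_gt0 (cumul0 s) A_root rootA A_C C_coroot PiE hiE).
exact: (Perm_sub_Adm m_gt0 (cumul0 s) (cocumul0 s R) A_root rootA A_C C_coroot
  PiE hiE).
Qed.
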